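(* Let $G$ be a Hilbert space and let $L$ be the generator of a uniformly continuous normal CP-semigroup $T=(T_t)_{t\ge 0}$, $T_t=e^{tL}$, on $\mathscr{B}(G)$, given in Gorini-Kossakowski-Sudarshan-Lindblad form $$L(b)=\sum_{i\in I}L_i^*bL_i+b\beta+\beta^*b\qquad(b\in\mathscr{B}(G)),$$ with $L_i,\beta\in\mathscr{B}(G)$. Let $\mathcal{C}\subset\mathscr{B}(G)$ be a maximal abelian von Neumann algebra. Then $L$ leaves $\mathcal{C}$ invariant, that is, $L(\mathcal{C})\subset\mathcal{C}$ (equivalently, all $T_t$ leave $\mathcal{C}$ invariant, that is, $T_t(\mathcal{C})\subset\mathcal{C}$ for all $t\ge 0$), if and only if there exist coefficients $\gamma=\gamma^*\in\mathcal{C}$ and $c_i\in\mathcal{C}$ $(i\in I)$, and for every $c\in\mathcal{C}$ there exist coefficients $c_{ij}(c)\in\mathcal{C}$ $(i,j\in I)$, such that for all $c\in\mathcal{C}$: 1. $c_{ij}(c^* )=c_{ji}(c)^*$ for all $i,j\in I$; 2. $cL_i-L_ic=\sum_{j\in I}c_{ij}(c)(L_j-c_j)$ for all $i\in I$; 3. $L(c)=\sum_{i\in I}(L_i-c_i)^*c(L_i-c_i)+\gamma c$.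
   Context: $\mathscr{B}(G)$ is the algebra of bounded operators on the Hilbert space $G$. A CP-map is a completely positive linear map. A uniformly continuous normal CP-semigroup on $\mathscr{B}(G)$ is a norm-continuous one-parameter semigroup $(T_t)_{t\ge0}$, $T_0=\mathrm{id}$, of normal CP-maps on $\mathscr{B}(G)$; its generator is the bounded map $L$ with $T_t=e^{tL}$. $I$ is an index set; if it is infinite, infinite sums are understood as strongly convergent. A maximal abelian von Neumann algebra (masa) in $\mathscr{B}(G)$ is a commutative von Neumann subalgebra containing the identity and not properly contained in any other commutative subalgebra of $\mathscr{B}(G)$.
   Formalization: For infinite I, condition 2 is required to converge strongly as an identity of columns (in the direct sum of copies of G indexed by i), not only for each i separately; with separate convergence for each i the ''if'' direction is false. *)

(* Defs.v *)
From HB Require Import structures.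
From mathcomp Require Import all_boot all_order all_algebra finmap.
From mathcomp Require Import complex.
From mathcomp Require Import all_classical all_reals all_analysis.
From mathcomp Require Import showcase.summability.

Set Implicit Arguments.
Unset Strict Implicit.
Unset Printing Implicit Defensive.
Import Order.TTheory GRing.Theory Num.Theory.
Import numFieldNormedType.Exports.
Local Open Scope classical_set_scope.
Local Open Scope ring_scope.
Local Open Scope complex_scope.

Section BoundedLinear.
Context {R : realType} {V W : normedModType R[i]}.

Definition bounded_linear : {pred V -> W} := fun f =>
  `[< linear f /\ exists M : R[i], forall x, `|f x| <= M * `|x| >].

Record blin := Blin { blin_fun :> V -> W; _ : blin_fun \in bounded_linear }.

HB.instance Definition _ := [isSub for blin_fun].
HB.instance Definition _ := [Choice of blin by <:].

Lemma blin_linear (f : blin) : linear f.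
Proof. by case: f => f /= /[dup] /asboolP[lf bf] _. Qed.

Lemma blin_bounded (f : blin) : exists M : R[i], forall x, `|f x| <= M * `|x|.
Proof. by case: f => f /= /[dup] /asboolP[lf bf] _. Qed.

HB.instance Definition _ (f : blin) :=
  GRing.isLinear.Build R[i] V W *:%R f (blin_linear f).

Lemma blin_ext (f g : blin) : f =1 g -> f = g.
Proof. by move=> fg; apply/val_inj/funext. Qed.

Lemma bounded_linear_submod : submod_closed bounded_linear.
Proof.
split.
  apply/asboolP; split; first by move=> a x y; rewrite scaler0 addr0.
  by exists 0 => x; rewrite normr0 mul0r.
move=> a f g /asboolP[lf [M fM]] /asboolP[lg [N gN]]; apply/asboolP; split.
  move=> b x y; rewrite !fctE lf lg !scalerDr !scalerA [a * b]mulrC.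
  by rewrite addrACA.
exists (`|a| * M + N) => x; rewrite !fctE.
rewrite (le_trans (ler_normD _ _))// normrZ mulrDl lerD// -mulrA.
exact: ler_wpM2l.
Qed.

HB.instance Definition _ :=
  GRing.isSubmodClosed.Build R[i] (V -> W) bounded_linear bounded_linear_submod.
HB.instance Definition _ := [SubChoice_isSubLmodule of blin by <:].

Lemma blinD (f g : blin) x : (f + g) x = f x + g x. Proof. by []. Qed.
Lemma blinZ a (f : blin) x : (a *: f) x = a *: f x. Proof. by []. Qed.

Definition opnorm_set (f : blin) : set R :=
  [set complex.Re `|f x| | x in [set x | `|x| <= 1]].

Definition opnorm (f : blin) : R[i] := (sup (opnorm_set f))%:C.

Lemma complex_norm_Re (U : normedModType R[i]) (u : U) :
  (complex.Re `|u|)%:C = `|u|.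
Proof.
by have := normr_ge0 u; case: `|u| => a b; rewrite lecE /= => /andP[/eqP-> _].
Qed.

Lemma opnorm_has_sup f : has_sup (opnorm_set f).
Proof.
split; first by exists (complex.Re `|f 0|), 0; rewrite //= normr0.
have [M fM] := blin_bounded f; exists (complex.Re `|M|) => _ [x /= x1 <-].
rewrite -lecR complex_norm_Re.
have -> : (complex.Re `|M|)%:C = `|M|.
  by have := normr_ge0 M; case: `|M| => a b; rewrite lecE /= => /andP[/eqP-> _].
rewrite (le_trans (fM x))//.
have [|x0] := eqVneq `|x| 0; first by move=> ->; rewrite mulr0.
have M0 : 0 <= M.
  by rewrite -(pmulr_lge0 _ (_ : 0 < `|x|)) ?lt_def ?x0//= (le_trans _ (fM x)).
by rewrite ger0_norm// -[leRHS]mulr1 ler_wpM2l.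
Qed.

Lemma opnorm_ge0 f : 0 <= opnorm f.
Proof.
rewrite /opnorm ler0c; apply: sup_upper_bound; first exact: opnorm_has_sup.
by exists 0; rewrite /= ?normr0// linear0 normr0.
Qed.

Lemma le_opnorm (f : blin) x : `|f x| <= opnorm f * `|x|.
Proof.
have [->|x0] := eqVneq x 0; first by rewrite linear0 !normr0 mulr0.
have nx0 : 0 < `|x| by rewrite normr_gt0.
have nxV0 : 0 < `|x|^-1 by rewrite invr_gt0.
rewrite -ler_pdivrMr// mulrC -(gtr0_norm nxV0) -normrZ.
rewrite -linearZ -[leLHS]complex_norm_Re /opnorm lecR; apply: sup_upper_bound.
  exact: opnorm_has_sup.
exists ((`|x|^-1 : R[i]) *: x) => //=.
by rewrite normrZ normfV normr_id mulVf// gt_eqF.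
Qed.

Lemma opnorm_le (f : blin) (M : R[i]) :
  0 <= M -> (forall x, `|f x| <= M * `|x|) -> opnorm f <= M.
Proof.
move=> M0 fM; have ReM : (complex.Re M)%:C = M.
  by case: M M0 {fM} => a b; rewrite lecE /= => /andP[/eqP-> _].
rewrite /opnorm -ReM lecR; apply: ge_sup; first by case: (opnorm_has_sup f).
move=> _ [x /= x1 <-]; rewrite -lecR complex_norm_Re ReM.
by rewrite (le_trans (fM x))// -[leRHS]mulr1 ler_wpM2l.
Qed.

Lemma opnormD f g : opnorm (f + g) <= opnorm f + opnorm g.
Proof.
apply: opnorm_le => [|x]; first by rewrite addr_ge0 ?opnorm_ge0.
by rewrite blinD (le_trans (ler_normD _ _))// mulrDl lerD ?le_opnorm.
Qed.

Lemma opnormZ a f : opnorm (a *: f) = `|a| * opnorm f.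
Proof.
have le b g : opnorm (b *: g) <= `|b| * opnorm g.
  apply: opnorm_le => [|x]; first by rewrite mulr_ge0 ?opnorm_ge0.
  by rewrite blinZ normrZ -mulrA ler_wpM2l ?le_opnorm.
apply/eqP; rewrite eq_le le /=.
have [->|a0] := eqVneq a 0; first by rewrite normr0 mul0r opnorm_ge0.
rewrite -ler_pdivlMl ?normr_gt0// -normfV.
by rewrite -[in leLHS](scalerK a0 f) le.
Qed.

Lemma opnorm0_eq0 f : opnorm f = 0 -> f = 0.
Proof.
move=> f0; apply: blin_ext => x; apply/eqP; rewrite -normr_le0.
by rewrite (le_trans (le_opnorm f x))// f0 mul0r.
Qed.

HB.instance Definition _ :=
  Lmodule_isNormed.Build R[i] blin opnormD opnormZ opnorm0_eq0.

End BoundedLinear.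
Arguments blin {R} V W.

Section BoundedOperators.
Context {R : realType} {V : normedModType R[i]}.

Lemma blin_id_subproof : (id : V -> V) \in bounded_linear.
Proof. by apply/asboolP; split => //; exists 1 => x; rewrite mul1r. Qed.

Lemma blin_comp_subproof (f g : blin V V) :
  (f \o g : V -> V) \in bounded_linear.
Proof.
apply/asboolP; split; first by move=> a x y /=; rewrite !linearP.
exists (opnorm f * opnorm g) => x /=.
rewrite (le_trans (le_opnorm f _))// -mulrA ler_wpM2l ?opnorm_ge0//.
exact: le_opnorm.
Qed.

Definition blin_one : blin V V := Blin blin_id_subproof.
Definition blin_mul (f g : blin V V) : blin V V :=
  Blin (blin_comp_subproof f g).

Lemma blin_mulA : associative blin_mul.
Proof. by move=> f g h; apply: blin_ext. Qed.
Lemma blin_mul1 : left_id blin_one blin_mul.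
Proof. by move=> f; apply: blin_ext. Qed.
Lemma blin_mulr1 : right_id blin_one blin_mul.
Proof. by move=> f; apply: blin_ext. Qed.
Lemma blin_mulDl : left_distributive blin_mul +%R.
Proof. by move=> f g h; apply: blin_ext. Qed.
Lemma blin_mulDr : right_distributive blin_mul +%R.
Proof. by move=> f g h; apply: blin_ext => x /=; rewrite linearD. Qed.

(* "Pz" because the algebra is trivial when V = 0. *)
HB.instance Definition _ := GRing.Zmodule_isPzRing.Build (blin V V)
  blin_mulA blin_mul1 blin_mulr1 blin_mulDl blin_mulDr.

End BoundedOperators.

(* The inner product is linear in its first argument. *)
Record hilbert (R : realType) := Hilbert {
  hilbert_sort :> completeNormedModType R[i];
  inner : {dot hilbert_sort for Num.conj};
  hilbert_normE : forall x : hilbert_sort, `|x| ^+ 2 = inner x x }.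

Notation "''B' ( G )" := (blin G G) (at level 8, format "''B' ( G )") : type_scope.

Section OperatorsOnHilbertSpace.
Context {R : realType} {G : hilbert R}.
Implicit Types (a b : 'B(G)) (A D : set 'B(G)).

(* By the Riesz representation theorem the adjoint exists, so that the default
   value 0 is never used. *)
Definition adj a : 'B(G) :=
  xget 0 [set b : 'B(G) | forall x y, inner G (a x) y = inner G x (b y)].

Definition selfadjoint a := adj a = a.

Definition op_ge0 a := forall x, 0 <= inner G (a x) x.
Definition op_le a b := op_ge0 (b - a).

Definition op_lub D a :=
  (forall b, D b -> op_le b a) /\
  (forall c, selfadjoint c -> (forall b, D b -> op_le b c) -> op_le a c).

(* M as an operator on the direct sum of n copies of G. *)
Definition opmx_ge0 n (M : 'M['B(G)]_n) :=
  forall x : 'I_n -> G, 0 <= \sum_i \sum_j inner G (M i j (x j)) (x i).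

Definition completely_positive (T : 'B(G) -> 'B(G)) :=
  linear T /\ forall n (M : 'M['B(G)]_n), opmx_ge0 M -> opmx_ge0 (map_mx T M).

(* Order continuity; a directed set of self-adjoint operators is an increasing
   net indexed by itself. *)
Definition normal (T : 'B(G) -> 'B(G)) := forall D a,
  D !=set0 -> (forall b, D b -> selfadjoint b) ->
  (forall b c, D b -> D c -> exists2 d, D d & op_le b d /\ op_le c d) ->
  op_lub D a -> op_lub (T @` D) (T a).

Definition subalgebra A := [/\ A 0,
  forall (z : R[i]) a b, A a -> A b -> A (z *: a + b) &
  forall a b, A a -> A b -> A (a * b)].

Definition commutative_set A := forall a b, A a -> A b -> a * b = b * a.

(* The strong operator topology is the topology of pointwise convergence. *)
Definition strongly_closed A := forall b,
  closure [set (a : {ptws G -> G}) | a in A] (b : {ptws G -> G}) -> A b.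

Definition von_neumann_algebra A :=
  [/\ subalgebra A, forall a, A a -> A (adj a) & strongly_closed A].

Definition masa A := [/\ von_neumann_algebra A, A 1, commutative_set A &
  forall D, subalgebra D -> commutative_set D -> A `<=` D -> D = A].

Definition strong_sum (I : choiceType) (F : I -> 'B(G)) (S : 'B(G)) :=
  forall x, partial_sum F J x @[J --> totally] --> S x.

(* For all i, S_i = sum_j F_ij, read as one identity between the columns
   S = (S_i)_i and F_j = (F_ij)_i, i.e. between operators from G to the Hilbert
   space direct sum of copies of G indexed by i, where the sum over j converges
   strongly. If I is finite, the second conjunct follows from the first. If I is
   infinite it does not, and row-by-row convergence would not allow double sums
   over i and j to be exchanged: a hermitian scalar matrix with finitely many
   nonzero entries in each row, but unbounded, can have l2 eigenvectors for
   distinct eigenvalues that are not orthogonal. *)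
Definition strong_column_sum (I : choiceType) (F : I -> I -> 'B(G))
    (S : I -> 'B(G)) :=
  (forall i, strong_sum (F i) (S i)) /\
  forall x (e : R[i]), 0 < e -> \forall J \near totally, forall K : {fset I},
    \sum_(i <- K) `|(S i - partial_sum (F i) J) x| ^+ 2 <= e.

(* T t only matters for t >= 0. CP-maps are bounded, so that taking the T t to
   be bounded operators on B(G) is no restriction. *)
Definition uc_normal_CP_semigroup (T : R -> blin 'B(G) 'B(G)) :=
  [/\ T 0 = 1,
      forall s t, 0 <= s -> 0 <= t -> T (s + t) = T s * T t,
      forall t, 0 <= t -> completely_positive (T t) /\ normal (T t) &
      {within [set t : R | 0 <= t], continuous T}].

Definition generator (T : R -> blin 'B(G) 'B(G)) (L : blin 'B(G) 'B(G)) :=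
  forall t, 0 <= t ->
    series (fun k => (t ^+ k / k`!%:R)%:C *: L ^+ k) @ \oo --> T t.

Definition leaves_invariant (f : 'B(G) -> 'B(G)) A := forall a, A a -> A (f a).

End OperatorsOnHilbertSpace.

(* Main.v *)
From HB Require Import structures.
Require Import Defs.
From mathcomp Require Import all_boot all_order all_algebra finmap.
From mathcomp Require Import complex ring lra.
From mathcomp Require Import all_classical all_reals all_analysis.
From mathcomp Require Import showcase.summability.
Set Implicit Arguments.
Unset Strict Implicit.
Unset Printing Implicit Defensive.
Import Order.TTheory GRing.Theory Num.Theory.
Import numFieldNormedType.Exports.
Local Open Scope classical_set_scope.
Local Open Scope complex_scope.
Local Open Scope ring_scope.

(** Let K be the Hilbert space l2(I; G), let V : G -> K be the column of the L_i,
    and for c in B(G) let amp c be the operator on K that acts by c in every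
    coordinate. The Lindblad form of L says
      <amp b (V x), V y> = <L b x, y> - <beta x, adj b y> - <b x, beta y>,
    so that for the derivation delta c = amp c o V - V o c the operator beta
    drops out of the inner products:
      <delta a x, delta b y> = <g x, y>,
      g = L(adj b * a) - adj b * L a - L(adj b) * a + adj b * L 1 * a
    ([delta_ip]). If L leaves C invariant, then g lies in C.

    Necessity. Since C is abelian, g commutes with C, and the vectors delta a x
    span a subspace of K on which delta a x |-> delta a (c x) is a bounded
    involutive representation rho of C that commutes with amp C ([right_action_exists]).
    Thus delta is a derivation for the left action amp and the right action rho.
    It is inner: there is D : G -> K with D c = rho c D and
      (amp c - rho c) D = delta c.
    Indeed, for the unitaries u of C the vectors amp (adj u) (delta u x) form a
    bounded set, the orbit of 0 under an affine isometric action of an abelian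
    group, and averages over long pieces of the orbit give exactly the estimate
    by which the linear relation
      (amp (adj u) - rho (adj u)) z |-> adjoint (delta u) z
    extends to a bounded operator, the adjoint of D ([rel_bound],
    [implementer_exists]).
    Now V - D intertwines amp c and c, so that its entries c_i commute with C
    and hence lie in C; the entries of D are the L_i - c_i; and condition 2 is
    (amp c - rho c) D = delta c, read with the matrix entries c_ij(c) of
    amp c - rho c, which lie in C since this operator commutes with amp C. As
    rho is a right action through which D intertwines, adjoint D o amp c o D
    lies in C. Subtracting it from L c leaves an expression c k + adj k c with
    one operator k; it lies in C, so that all commutators of k with C lie in C,
    hence vanish ([commutator_masa_eq0]), and gamma = k + adj k.

    Sufficiency. Conditions 1 and 2 together say that
      <amp c (S x), D y> = <amp c (D x), S' y>
    for S = amp c' o D - D o c' and S' = amp (adj c') o D - D o adj c'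
    ([defect_move]), and this is the statement that adjoint D o amp c o D
    commutes with c'. With condition 3, L c commutes with C.

    The passage between L and the semigroup is the power series of the
    exponential in one direction and its derivative at 0 in the other; C is
    closed in norm, being its own commutant. *)
Local Notation Re := complex.Re.

(** * Inner products and norms *)
Lemma dot_CauchySchwarz (K : numClosedFieldType) (U : lmodType K)
    (f : {dot U for @Num.conj K}) (x y : U) :
  `|f x y| ^+ 2 <= f x x * f y y.
Proof.
have [->|y0] := eqVneq y 0; first by rewrite !linear0r normr0 expr0n/= ?mulr0.
have fy0 : 0 < f y y by exact: neq0_dnorm_gt0.
have fxy : f y x = (f x y)^* by have := hermC f y x; rewrite expr0 mul1r.
have := dnorm_ge0 f (f y y *: x - f x y *: y).
have -> : f (f y y *: x - f x y *: y) (f y y *: x - f x y *: y) =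
    f y y * (f x x * f y y - `|f x y| ^+ 2).
  rewrite normCK linearBl !linearBr !linearZl_LR !linearZr_LR /= fxy.
  by rewrite /GRing.scale /= [(f y y)^*]conj_Creal ?gtr0_real//; ring.
by rewrite pmulr_rge0// subr_ge0.
Qed.

Notation "''[' x , y ]" := (inner _ x y) (at level 0, format "''[' x ,  y ]").

Section InnerProduct.
Context {R : realType} {H : hilbert R}.
Implicit Types (x y z : H) (a : R[i]).

Lemma ipDl x y z : '[x + y, z] = '[x, z] + '[y, z].
Proof. exact: linearDl. Qed.
Lemma ipDr x y z : '[x, y + z] = '[x, y] + '[x, z].
Proof. exact: linearDr. Qed.
Lemma ipBl x y z : '[x - y, z] = '[x, z] - '[y, z].
Proof. exact: linearBl. Qed.
Lemma ipBr x y z : '[x, y - z] = '[x, y] - '[x, z].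
Proof. exact: linearBr. Qed.
Lemma ipNl x y : '[- x, y] = - '[x, y]. Proof. exact: linearNl. Qed.
Lemma ipNr x y : '[x, - y] = - '[x, y]. Proof. exact: linearNr. Qed.
Lemma ip0l x : '[0, x] = 0. Proof. exact: linear0l. Qed.
Lemma ip0r x : '[x, 0] = 0. Proof. exact: linear0r. Qed.
Lemma ipZl a x y : '[a *: x, y] = a * '[x, y].
Proof. exact: linearZl_LR. Qed.
Lemma ipZr a x y : '[x, a *: y] = a^* * '[x, y].
Proof. exact: linearZr_LR. Qed.
Lemma ipC x y : '[x, y] = '[y, x]^*.
Proof. by have := hermC (inner H) x y; rewrite /= expr0 mul1r. Qed.
Lemma ip_suml (J : Type) (r : seq J) (F : J -> H) y :
  '[\sum_(j <- r) F j, y] = \sum_(j <- r) '[F j, y].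
Proof. by elim/big_rec2: _ => [|j a x _ <-]; rewrite ?ip0l ?ipDl. Qed.
Lemma ip_sumr (J : Type) (r : seq J) (F : J -> H) x :
  '[x, \sum_(j <- r) F j] = \sum_(j <- r) '[x, F j].
Proof. by elim/big_rec2: _ => [|j a y _ <-]; rewrite ?ip0r ?ipDr. Qed.

Lemma ipxx x : '[x, x] = `|x| ^+ 2. Proof. by rewrite hilbert_normE. Qed.

Lemma ipxx_eq0 x : '[x, x] = 0 -> x = 0.
Proof. by move/eqP; rewrite ipxx sqrf_eq0 normr_eq0 => /eqP. Qed.

Lemma ip_le x y : `|'[x, y]| <= `|x| * `|y|.
Proof.
have := dot_CauchySchwarz (inner H) x y; rewrite !ipxx -exprMn.
by rewrite ler_sqr ?nnegrE ?mulr_ge0.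
Qed.

Lemma ip_ext x y : (forall z, '[x, z] = '[y, z]) -> x = y.
Proof.
by move=> xy; apply/eqP; rewrite -subr_eq0; apply/eqP/ipxx_eq0; rewrite ipBl xy subrr.
Qed.

End InnerProduct.

Section Hn.
Context {R : realType}.

(** Norms take values in R[i]. Estimates are carried out with the real number
    behind them, because the order of R[i] is only partial. *)
Definition rnorm {V : normedModType R[i]} (x : V) : R := complex.Re `|x|.

Lemma rnormE {V : normedModType R[i]} (x : V) : (rnorm x)%:C = `|x|.
Proof. exact: complex_norm_Re. Qed.

Lemma rnorm_ge0 {V : normedModType R[i]} (x : V) : 0 <= rnorm x.
Proof. by rewrite -ler0c rnormE. Qed.

Lemma rnorm_sqC {H : hilbert R} (x : H) : (rnorm x ^+ 2)%:C = '[x, x].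
Proof. by rewrite ipxx rmorphXn /= rnormE. Qed.

Lemma gt0_complexE (e : R[i]) : 0 < e -> exists2 r : R, e = r%:C & 0 < r.
Proof. by case: e => a b; rewrite ltcE /= => /andP[/eqP -> ?]; exists a. Qed.

Lemma cauchy_seq {V : completeNormedModType R[i]} (u : nat -> V) :
  (forall e : R, 0 < e -> exists N, forall n m, (N <= n)%N -> (N <= m)%N ->
     rnorm (u n - u m) < e) -> exists z : V, u @ \oo --> z.
Proof.
move=> uC; suff : cvg (u @ \oo) by move=> /cvg_ex[z uz]; exists z.
apply: cauchy_cvg; apply/cauchy_ballP => e e0.
have [e' -> {e0} e0] := gt0_complexE e0.
have [N NP] := uC _ e0.
exists (u @` [set n | (N <= n)%N], u @` [set n | (N <= n)%N]) => /=.
  by split; exists N => // n /= Nn; exists n.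
move=> [_ _] /= [[n Nn <-] [m Nm <-]].
rewrite -ball_normE /ball_ /= -rnormE ltcR; exact: NP.
Qed.

End Hn.

(** * Riesz representation for bounded linear relations *)
Section Riesz.
Context {R : realType}.

Lemma Re_add (a b : R[i]) : Re (a + b) = Re a + Re b.
Proof. by case: a b => ? ? []. Qed.
Lemma Re_sub (a b : R[i]) : Re (a - b) = Re a - Re b.
Proof. by case: a b => ? ? []. Qed.
Lemma Re_real (r : R) : Re r%:C = r. Proof. by []. Qed.
Lemma Re_conj (a : R[i]) : Re a^* = Re a. Proof. by case: a. Qed.
Lemma Re_scale (r : R) (a : R[i]) : Re (r%:C * a) = r * Re a.
Proof. by case: a => x y /=; rewrite mul0r subr0. Qed.
Lemma Re_le (a : R[i]) (r : R) : `|a| <= r%:C -> `|Re a| <= r.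
Proof. by move=> ar; rewrite -lecR; exact: le_trans (normc_ge_Re a) ar. Qed.

Lemma normC_Re (a : R[i]) : (Re `|a|)%:C = `|a|.
Proof. by rewrite normc_def. Qed.
Lemma Re_norm_ge0 (a : R[i]) : 0 <= Re `|a|.
Proof. by rewrite -ler0c normC_Re. Qed.
Lemma Re_norm_sq (a : R[i]) : Re `|a| ^+ 2 = Re (a * a^*).
Proof. by rewrite -normCK -[in RHS]normC_Re -rmorphXn. Qed.

Lemma rnorm_sq {H : hilbert R} (x : H) : rnorm x ^+ 2 = Re '[x, x].
Proof. by rewrite -rnorm_sqC. Qed.

Lemma Re_ip_le {H : hilbert R} (x y : H) : `|Re '[x, y]| <= rnorm x * rnorm y.
Proof. by apply: Re_le; rewrite rmorphM /= !rnormE ip_le. Qed.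

Lemma rnormD {V : normedModType R[i]} (x y : V) : rnorm (x + y) <= rnorm x + rnorm y.
Proof. by rewrite -lecR rmorphD /= !rnormE ler_normD. Qed.

Lemma rnorm_sqD {H : hilbert R} (x y : H) :
  rnorm (x + y) ^+ 2 = rnorm x ^+ 2 + rnorm y ^+ 2 + 2 * Re '[x, y].
Proof.
rewrite !rnorm_sq ipDl !ipDr !Re_add [ '[y, x] ]ipC Re_conj; ring.
Qed.

Lemma rnormZ {V : normedModType R[i]} (a : R[i]) (x : V) :
  rnorm (a *: x) = Re `|a| * rnorm x.
Proof. by rewrite -[LHS]Re_real rnormE normrZ -rnormE -normC_Re -rmorphM. Qed.

Lemma rnormN {V : normedModType R[i]} (x : V) : rnorm (- x) = rnorm x.
Proof. by rewrite /rnorm normrN. Qed.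

Lemma rnorm_sqZ {H : hilbert R} (a : R[i]) (x : H) :
  rnorm (a *: x) ^+ 2 = Re (a * a^*) * rnorm x ^+ 2.
Proof.
rewrite !rnorm_sq ipZl ipZr mulrA -rnorm_sqC; case: (a * a^*) => u v /=.
by rewrite mulr0 subr0.
Qed.

Lemma rnorm_sqB {H : hilbert R} (x y : H) :
  rnorm (x - y) ^+ 2 = 2 * rnorm x ^+ 2 + 2 * rnorm y ^+ 2 - rnorm (x + y) ^+ 2.
Proof. rewrite !rnorm_sqD rnormN ipNr; case: '[x, y] => u v /=; ring. Qed.

Definition perp {H : hilbert R} (X : set H) : set H :=
  [set z | forall p, X p -> '[p, z] = 0].

Lemma le0_all_eps (a : R) : (forall e, 0 < e -> a <= e) -> a <= 0.
Proof. by move=> h; apply/ler_addgt0Pl => e e0; rewrite addr0 h. Qed.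

(** The inner product is continuous in its second argument; the hypothesis is
    kept as an approximation property so that l need not come with a limit. *)
Lemma ip_cvgl {H : hilbert R} (u : nat -> H) (z p : H) (l : R[i]) :
  u @ \oo --> z ->
  (forall e : R, 0 < e -> \forall n \near \oo, Re `|l - '[p, u n]| <= e) ->
  l = '[p, z].
Proof.
move=> uz ul; apply/eqP; rewrite -subr_eq0 -normr_eq0 -normC_Re.
suff -> : Re `|l - '[p, z]| = 0 by [].
apply/eqP; rewrite eq_le Re_norm_ge0 andbT.
apply: le0_all_eps => e e0.
have e2 : 0 < e / 2 by rewrite divr_gt0.
have hp : 0 < rnorm p + 1 by rewrite ltr_wpDl ?rnorm_ge0.
have e3 : 0 < e / 2 / (rnorm p + 1) by rewrite divr_gt0.
have /cvgrPdist_le /(_ (e / 2 / (rnorm p + 1))%:C) := uz.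
rewrite ltcR => /(_ e3) h1; have h2 := ul _ e2.
have [n [n1 n2]] := filter_ex (filterI h1 h2).
rewrite -lecR normC_Re.
rewrite (_ : l - _ = (l - '[p, u n]) - '[p, z - u n]); last by rewrite ipBr; ring.
rewrite (le_trans (ler_normB _ _))//.
rewrite (_ : e = e / 2 + e / 2); last by lra.
rewrite rmorphD /= lerD//; first by rewrite -normC_Re lecR.
rewrite (le_trans (ip_le _ _))// (le_trans (ler_wpM2l _ n1))// -rnormE -rmorphM lecR.
rewrite mulrCA ger_pMr//.
by rewrite ler_pdivrMr// mul1r lerDl.
Qed.

(** Functionals are given by their graphs, on arbitrary subspaces. The
    representing vector minimizes the quadratic form J on the graph;
    it is unique once it is required to lie in the closure of the domain, which
    is the double orthogonal complement [perp (perp dom)]. *)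
Section RieszRelation.
Variables (H : hilbert R) (rel : H -> R[i] -> Prop) (M : R).
Hypotheses (M0 : 0 <= M) (rel0 : rel 0 0)
  (rellin : forall a p l q k, rel p l -> rel q k -> rel (a *: p + q) (a * l + k))
  (relM : forall p l, rel p l -> `|l| <= (M * rnorm p)%:C).

Let J (pl : H * R[i]) := rnorm pl.1 ^+ 2 - 2 * Re pl.2.
Let S := [set J pl | pl in [set pl | rel pl.1 pl.2]].

Let S_inf : has_inf S.
Proof.
split; first by exists (J (0, 0)), (0, 0).
exists (- M ^+ 2) => _ [[p l] /= /relM pl <-]; rewrite /J /=.
have := Re_le pl; rewrite ler_norml => /andP[_ h].
have := sqr_ge0 (rnorm p - M); nra.
Qed.

Let minimizing : exists u : nat -> H * R[i], forall n,
  rel (u n).1 (u n).2 /\ J (u n) < inf S + n.+1%:R^-1.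
Proof.
suff /boolp.choice[u uP] : forall n : nat, exists pl : H * R[i],
    rel pl.1 pl.2 /\ J pl < inf S + n.+1%:R^-1 by exists u.
move=> n; have [|_ [pl /= ? <-] ?] := @inf_adherent _ S n.+1%:R^-1 _ S_inf.
  by rewrite invr_gt0.
by exists pl.
Qed.

Let J_ge p l : rel p l -> inf S <= J (p, l).
Proof. by move=> pl; apply: (inf_lbound S_inf.2); exists (p, l). Qed.

Lemma inv_small (e : R) : 0 < e -> exists N, forall n, (N <= n)%N -> n.+1%:R^-1 <= e.
Proof.
move=> e0; have [N _ NP] := near_infty_natSinv_lt (PosNum e0).
by exists N => n Nn; apply: ltW; apply: NP.
Qed.

Lemma riesz_relation : exists z : H,
  [/\ forall p l, rel p l -> l = '[p, z],
      perp (perp [set p | exists l, rel p l]) z & rnorm z <= M].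
Proof.
have [u uP] := minimizing.
have [z uz] : exists z : H, (fun n => (u n).1) @ \oo --> z.
  apply: cauchy_seq => e e0.
  have [|N NP] := @inv_small (e ^+ 2 / 8); first by rewrite divr_gt0 ?exprn_gt0.
  exists N => n m Nn Nm; have [rn Jn] := uP n; have [rm Jm] := uP m.
  (* Parallelogram law: the midpoint of two almost minimizing vectors cannot
     have a much smaller value of J, so the vectors are close. *)
  rewrite -(ltr_pXn2r (n := 2))// ?nnegrE ?rnorm_ge0 ?ltW// rnorm_sqB.
  have := J_ge (rellin 2^-1 (rellin 1 rn rm) rel0).
  rewrite /J /= !scale1r !mul1r !addr0.
  have -> : (2^-1 : R[i]) = (2^-1 : R)%:C by rewrite fmorphV /= rmorph_nat.
  rewrite rnorm_sqZ !Re_scale Re_conj Re_real Re_add.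
  move: Jn Jm (NP _ Nn) (NP _ Nm); rewrite /J.
  move: (n.+1%:R^-1) (m.+1%:R^-1) (inf S) => a b c.
  move: (rnorm (u n).1 ^+ 2) (rnorm (u m).1 ^+ 2) (rnorm (_ + _) ^+ 2) => x y w.
  move: (Re (u n).2) (Re (u m).2) => v v' *.
  have e2 : 0 < e ^+ 2 by rewrite exprn_gt0.
  lra.
have zP p l : rel p l -> l = '[p, z].
  move=> pl; apply: (ip_cvgl uz) => e e0.
  (* First variation at the almost minimizing u n, in the direction of p with
     the coefficient s times the conjugate of the error d. The value of s makes
     the second order term at most half of the first order term. *)
  pose s := (1 + rnorm p ^+ 2)^-1.
  have s0 : 0 < s by rewrite invr_gt0 ltr_pwDl// sqr_ge0.
  have [|N NP] := @inv_small (e ^+ 2 * s); first by rewrite mulr_gt0 ?exprn_gt0.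
  exists N => // n /= Nn; have [rn Jn] := uP n.
  pose d := l - '[p, (u n).1].
  rewrite -/d -(ler_pXn2r (n := 2))// ?nnegrE ?Re_norm_ge0 ?(ltW e0)//.
  have /J_ge := rellin ((s%:C) * d^*) pl rn.
  rewrite {1}/J /= rnorm_sqD rnorm_sqZ ipZl.
  have -> : Re (s%:C * d^* * (s%:C * d^*)^*) = s ^+ 2 * Re (d * d^*).
    by case: (d) => x y /=; ring.
  have dE : Re (s%:C * d^* * '[p, (u n).1]) - Re (s%:C * d^* * l) =
      - (s * Re (d * d^*)).
    rewrite -Re_sub -mulrBr -mulrA Re_scale -mulrN; congr (_ * _).
    by rewrite /d; case: l {pl d} => x y; case: '[_, _] => x' y' /=; ring.
  rewrite Re_add; move: Jn (NP _ Nn) dE; rewrite /J -(Re_norm_sq d).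
  have sq : s * (1 + rnorm p ^+ 2) = 1.
    by rewrite mulVf// gt_eqF// ltr_pwDl// sqr_ge0.
  move: (n.+1%:R^-1) (inf S) (Re `|d| ^+ 2) (sqr_ge0 (Re `|d|)) => a c D D0.
  move: (rnorm (u n).1 ^+ 2) (rnorm p ^+ 2) sq => x y sq.
  move: (Re (u n).2) (Re (_ * l)) (Re (_ * '[_, _])) => v v' w *.
  rewrite -(ler_pM2l s0).
  have : s ^+ 2 * D * y = s * D - s ^+ 2 * D.
    rewrite (_ : s ^+ 2 * D * y = s * (s * (1 + y)) * D - s ^+ 2 * D); last by ring.
    by rewrite sq mulr1.
  have : 0 <= s ^+ 2 * D by rewrite mulr_ge0// sqr_ge0.
  lra.
exists z; split => //.
  move=> q qP; apply/esym.
  apply: (ip_cvgl uz) => e e0; exists 0%N => // n _.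
  have [rn _] := uP n.
  rewrite [ '[q, _] ]ipC qP; last by exists (u n).2.
  by rewrite conjC0 subrr normr0 /= ltW.
suff : rnorm z ^+ 2 - M * rnorm z <= 0.
  have := rnorm_ge0 z; rewrite le_eqVlt => /predU1P[<- //|z0].
  by rewrite expr2 -mulrBl pmulr_lle0// subr_le0.
apply: le0_all_eps => e e0.
have c0 : 0 < rnorm z + M + 1 by rewrite ltr_wpDl// addr_ge0// rnorm_ge0.
have e3 : 0 < e / (rnorm z + M + 1) by rewrite divr_gt0.
have /cvgrPdist_le /(_ (e / (rnorm z + M + 1))%:C) := uz.
rewrite ltcR => /(_ e3) /filter_ex[n]; rewrite -rnormE lecR.
move eE : (e / _) => f fP; have [rn _] := uP n.
have h1 := Re_le (relM rn); have h2 := zP _ _ rn; move: h1; rewrite h2 => h1.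
have h3 : rnorm z ^+ 2 = Re '[z - (u n).1, z] + Re '[(u n).1, z].
  by rewrite -Re_add -ipDl subrK rnorm_sq.
have h4 := Re_ip_le (z - (u n).1) z.
have h5 : rnorm (u n).1 <= rnorm z + f.
  rewrite (_ : (u n).1 = z - (z - (u n).1)); last by rewrite opprB addrC subrK.
  by rewrite (le_trans (rnormD _ _))// rnormN lerD2l.
move: h1 h4; rewrite !ler_norml => /andP[_ h1] /andP[_ h4].
have h6 : f * (rnorm z + M + 1) = e by rewrite -eE divfK// gt_eqF.
have f0 : 0 < f by rewrite -eE.
have h7 : rnorm (z - (u n).1) * rnorm z <= f * rnorm z by rewrite ler_wpM2r// rnorm_ge0.
have h8 : M * rnorm (u n).1 <= M * (rnorm z + f) by rewrite ler_wpM2l.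
by nra.
Qed.
End RieszRelation.
End Riesz.

(** * Adjoints and extension of bounded linear relations *)
Section Extension.
Context {R : realType}.
Implicit Types H : hilbert R.

Lemma blin_of {V W : normedModType R[i]} (f : V -> W) (M : R) : linear f ->
  (forall x, rnorm (f x) <= M * rnorm x) -> exists T : blin V W, forall x, T x = f x.
Proof.
move=> lf fM; suff fP : f \in bounded_linear by exists (Blin fP).
apply/asboolP; split=> //; exists M%:C => x.
by rewrite -!rnormE -rmorphM lecR.
Qed.

Lemma blin_rnorm_bound {V W : normedModType R[i]} (T : blin V W) :
  exists2 M : R, 0 <= M & forall x, rnorm (T x) <= M * rnorm x.
Proof.
exists (Re (opnorm T)); first by rewrite -ler0c /opnorm opnorm_ge0.
by move=> x; rewrite -lecR rmorphM /= !rnormE; exact: le_opnorm.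
Qed.

Lemma adjoint_exists {H1 H2} (a : blin H1 H2) :
  exists b : blin H2 H1, forall x y, '[a x, y] = '[x, b y].
Proof.
have [M M0 aM] := blin_rnorm_bound a.
have /boolp.choice[b bP] : forall y : H2, exists z : H1,
    (forall x, '[a x, y] = '[x, z]) /\ rnorm z <= M * rnorm y.
  move=> y.
  have [||||z [zP _ zM]] := @riesz_relation _ H1 (fun p l => l = '[a p, y]) (M * rnorm y).
  - by rewrite mulr_ge0// rnorm_ge0.
  - by rewrite linear0 ip0l.
  - by move=> c p l q k -> ->; rewrite linearP ipDl ipZl.
  - move=> p l ->; rewrite (le_trans (ip_le _ _))// -!rnormE -rmorphM lecR.
    by rewrite mulrAC ler_wpM2r// rnorm_ge0.
  - by exists z; split=> // x; apply: zP.
have [||T TP] := @blin_of _ _ b M.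
- move=> c x y; apply: ip_ext => z.
  rewrite [LHS]ipC [RHS]ipC; congr _^*.
  by rewrite -(bP _).1 ipDr ipZr [RHS]ipDr ipZr -!(bP _).1.
- by move=> y; exact: (bP y).2.
by exists T => x y; rewrite TP (bP y).1.
Qed.

(** The same choice as in [adj], for operators between two Hilbert spaces. *)
Definition adjoint {H1 H2} (a : blin H1 H2) : blin H2 H1 :=
  xget 0 [set b : blin H2 H1 | forall x y, '[a x, y] = '[x, b y]].

Lemma adjointE {H1 H2} (a : blin H1 H2) x y : '[a x, y] = '[x, adjoint a y].
Proof.
rewrite /adjoint; case: xgetP => [b _ -> //|]; have [b bP] := adjoint_exists a.
by move/(_ b); rewrite /= => /(_ bP).
Qed.

Lemma adjointEl {H1 H2} (a : blin H1 H2) x y : '[adjoint a x, y] = '[x, a y].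
Proof. by rewrite ipC -adjointE -ipC. Qed.

Lemma adj_adjoint {H} (a : 'B(H)) : adj a = adjoint a.
Proof. by []. Qed.

Lemma adjoint_unique {H1 H2} (a : blin H1 H2) (b : blin H2 H1) :
  (forall x y, '[a x, y] = '[x, b y]) -> adjoint a = b.
Proof.
move=> ab; apply: blin_ext => y; apply: ip_ext => x.
by rewrite ipC -adjointE ab -ipC.
Qed.

Lemma perp_lin {H} (X : set H) a x y : perp X x -> perp X y -> perp X (a *: x + y).
Proof. by move=> Xx Xy p Xp; rewrite ipDr ipZr Xx// Xy// mulr0 addr0. Qed.

Lemma perp_perp0 {H} (X : set H) x : perp X x -> perp (perp X) x -> x = 0.
Proof. by move=> Xx XXx; apply: ipxx_eq0; exact: XXx. Qed.

Lemma perp_sub {H} (X Y : set H) : X `<=` Y -> perp Y `<=` perp X.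
Proof. by move=> XY z Yz p Xp; apply: Yz; apply: XY. Qed.

(** A bounded linear relation, given on any subspace, extends to an operator
    that vanishes on the orthogonal complement of the domain and takes values
    in the closure of the range. The proof constructs the adjoint S of the
    extension: S y represents the functional p |-> <q, y> on the domain. *)
Section RelationExtension.
Variables (H1 H2 : hilbert R) (rel : H1 -> H2 -> Prop) (M : R).
Hypotheses (M0 : 0 <= M) (rel0 : rel 0 0)
  (rellin : forall a p q p' q', rel p q -> rel p' q' ->
     rel (a *: p + p') (a *: q + q'))
  (relM : forall p q, rel p q -> rnorm q <= M * rnorm p).

Let dom := [set p | exists q, rel p q].
Let ran := [set q | exists p, rel p q].

Lemma relation_extension : exists T : blin H1 H2,
  [/\ forall p q, rel p q -> T p = q, forall x, perp dom x -> T x = 0,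
      forall x, perp (perp ran) (T x) & forall x, rnorm (T x) <= M * rnorm x].
Proof.
have /boolp.choice[s sP] : forall y : H2, exists z : H1,
    [/\ forall p q, rel p q -> '[q, y] = '[p, z], perp (perp dom) z &
        rnorm z <= M * rnorm y].
  move=> y.
  have [||||z [zP zd zM]] := @riesz_relation _ H1
    (fun p l => exists2 q, rel p q & l = '[q, y]) (M * rnorm y).
  - by rewrite mulr_ge0// rnorm_ge0.
  - by exists 0; rewrite ?ip0l.
  - move=> c p l q k [p' pp' ->] [q' qq' ->]; exists (c *: p' + q').
      exact: rellin.
    by rewrite ipDl ipZl.
  - move=> p l [q pq ->]; rewrite (le_trans (ip_le _ _))// -!rnormE -rmorphM lecR.
    by rewrite mulrAC ler_wpM2r// ?rnorm_ge0// relM.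
  - exists z; split=> //; first by move=> p q pq; apply: zP; exists q.
    apply: perp_sub zd; apply: perp_sub => p [l [q pq _]].
    by exists q.
have sE y y' p q : rel p q -> perp (perp dom) y' ->
    (forall p q, rel p q -> '[q, y] = '[p, y']) -> s y = y'.
  move=> pq y'd yy'; have [h1 h2 _] := sP y.
  apply/eqP; rewrite -subr_eq0; apply/eqP/(@perp_perp0 _ dom).
    by move=> p' [q' pq']; rewrite ipBr -(h1 _ _ pq') -(yy' _ _ pq') subrr.
  by rewrite -scaleN1r addrC; apply: perp_lin.
have [||S SP] := @blin_of _ _ s M.
- move=> c x y; have [hx1 hx2 _] := sP x; have [hy1 hy2 _] := sP y.
  apply: (sE _ _ _ _ rel0); first exact: perp_lin.
  by move=> p q pq; rewrite ipDr ipZr (hx1 _ _ pq) (hy1 _ _ pq) ipDr ipZr.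
- by move=> y; have [] := sP y.
have TE x y : '[adjoint S x, y] = '[x, s y] by rewrite adjointEl SP.
exists (adjoint S); split.
- move=> p q pq; apply: ip_ext => y; rewrite TE.
  by have [h _ _] := sP y; rewrite -(h _ _ pq).
- move=> x dx; apply: ip_ext => y; rewrite TE ip0l.
  by have [_ h _] := sP y; exact: (h _ dx).
- move=> x z rz; rewrite ipC TE [X in '[_, X]](sE _ 0 _ _ rel0) ?ip0r ?conjC0//.
    by move=> p _; rewrite ip0r.
  by move=> p q pq; rewrite ip0r; apply: rz; exists p.
- move=> x; have := rnorm_ge0 (adjoint S x).
  rewrite le_eqVlt => /predU1P[<-|Tx0].
    by rewrite mulr_ge0// rnorm_ge0.
  rewrite -(ler_pM2r Tx0) -expr2 rnorm_sq TE.
  have := Re_ip_le x (s (adjoint S x)); rewrite ler_norml => /andP[_ h].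
  rewrite (le_trans h)//; have [_ _ h2] := sP (adjoint S x).
  by rewrite (le_trans (ler_wpM2l (rnorm_ge0 _) h2))// mulrCA mulrA.
Qed.
End RelationExtension.

(** The range of the adjoint of T lies in the complement of X, where T
    vanishes. *)
Lemma blin_eq0_perp {H1 H2} (T : blin H1 H2) (X : set H1) :
  (forall x, X x -> T x = 0) -> (forall x, perp X x -> T x = 0) -> T = 0.
Proof.
move=> TX TXp; have T0 y : adjoint T y = 0.
  apply: ipxx_eq0; rewrite -adjointE TXp ?ip0l// => p Xp.
  by rewrite -adjointE TX// ip0l.
by apply: blin_ext => x; apply: ip_ext => y; rewrite adjointE T0 ip0r ip0l.
Qed.

End Extension.

(** * Unordered sums of complex numbers *)
Section UnorderedSums.
Context {R : realType} {I : choiceType}.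
Implicit Types (F : I -> R[i]) (l : R[i]) (J : {fset I}).

Lemma Re_normD (a b : R[i]) : Re `|a + b| <= Re `|a| + Re `|b|.
Proof. by rewrite -lecR rmorphD /= !normC_Re ler_normD. Qed.
Lemma Re_normM (a b : R[i]) : Re `|a * b| = Re `|a| * Re `|b|.
Proof. by apply: complexI; rewrite rmorphM /= !normC_Re normrM. Qed.
Lemma Re_norm_eq0 (a : R[i]) : Re `|a| <= 0 -> a = 0.
Proof. by rewrite -lecR normC_Re normr_le0 => /eqP. Qed.

(** Convergence along the net of finite subsets; the error is measured in R. *)
Definition has_sum F l := forall e : R, 0 < e ->
  exists J0, forall J, (J0 `<=` J)%fset -> Re `|l - \sum_(i <- J) F i| <= e.

Lemma has_sum_unique F l l' : has_sum F l -> has_sum F l' -> l = l'.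
Proof.
move=> Fl Fl'; apply/eqP; rewrite -subr_eq0; apply/eqP/Re_norm_eq0/le0_all_eps => e e0.
have e2 : 0 < e / 2 by rewrite divr_gt0.
have [J0 h0] := Fl _ e2; have [J1 h1] := Fl' _ e2.
have := h0 (J0 `|` J1)%fset (fsubsetUl _ _).
have := h1 (J0 `|` J1)%fset (fsubsetUr _ _).
set s := \sum_(_ <- _) _ => h1' h0'.
rewrite (_ : l - l' = (l - s) + - (l' - s)); last by ring.
by rewrite (le_trans (Re_normD _ _))// normrN (splitr e) lerD.
Qed.

Lemma has_sum_lin (a : R[i]) F G l k :
  has_sum F l -> has_sum G k -> has_sum (fun i => a * F i + G i) (a * l + k).
Proof.
move=> Fl Gk e e0; pose c := Re `|a| + 1.
have c0 : 0 < c by rewrite ltr_wpDl// Re_norm_ge0.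
have [J0 h0] := Fl (e / 2 / c) (divr_gt0 (divr_gt0 e0 (ltr0Sn _ _)) c0).
have [J1 h1] := Gk (e / 2) (divr_gt0 e0 (ltr0Sn _ _)).
exists (J0 `|` J1)%fset => J; rewrite fsubUset => /andP[/h0 {}h0 /h1 {}h1].
rewrite big_split -mulr_sumr /=.
set s := \sum_(_ <- _) F _ in h0 *; set t := \sum_(_ <- _) G _ in h1 *.
rewrite (_ : _ - _ = a * (l - s) + (k - t)); last by ring.
rewrite (le_trans (Re_normD _ _))// (splitr e) lerD// Re_normM.
rewrite (le_trans (ler_wpM2l (Re_norm_ge0 _) h0))//.
rewrite mulrCA ger_pMr ?divr_gt0// ler_pdivrMr// mul1r /c lerDl //.
Qed.

Lemma has_sum_ext F G l : F =1 G -> has_sum F l -> has_sum G l.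
Proof. by move=> /funext ->. Qed.

Lemma has_sum0 : has_sum (fun _ => 0) 0.
Proof. by move=> e e0; exists fset0 => J _; rewrite big1// subrr normr0 ltW. Qed.

Lemma has_sumZ a F l : has_sum F l -> has_sum (fun i => a * F i) (a * l).
Proof.
move=> Fl; have := has_sum_lin a Fl has_sum0; rewrite addr0.
by apply: has_sum_ext => i; rewrite addr0.
Qed.

Lemma has_sumD F G l k :
  has_sum F l -> has_sum G k -> has_sum (fun i => F i + G i) (l + k).
Proof.
move=> Fl Gk; have := has_sum_lin 1 Fl Gk; rewrite mul1r.
by apply: has_sum_ext => i; rewrite mul1r.
Qed.

Lemma has_sum_conj F l : has_sum F l -> has_sum (fun i => (F i)^*) l^*.
Proof.
move=> Fl e /Fl[J0 h]; exists J0 => J /h.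
by rewrite -rmorph_sum -rmorphB norm_conjC.
Qed.

Lemma ler_sum_fset (a : I -> R) J0 J : (forall i, 0 <= a i) -> (J0 `<=` J)%fset ->
  \sum_(i <- J0) a i <= \sum_(i <- J) a i.
Proof.
move=> a0 J0J; rewrite [leRHS](big_fsetID _ (mem J0)) /=.
have -> : [fset i in J | i \in J0]%fset = J0.
  apply/fsetP => i; rewrite !inE /= andb_idl//.
  exact: (fsubsetP J0J).
by rewrite lerDl sumr_ge0.
Qed.

Lemma nneg_has_sum (a : I -> R) M : (forall i, 0 <= a i) ->
  (forall J, \sum_(i <- J) a i <= M) ->
  exists s, [/\ has_sum (fun i => (a i)%:C) s%:C, forall J, \sum_(i <- J) a i <= s
    & s <= M].
Proof.
move=> a0 aM; pose S := [set \sum_(i <- J) a i | J in [set: {fset I}]].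
have S0 : S !=set0 by exists (\sum_(i <- fset0) a i), fset0.
have Sub : ubound S M by move=> _ [J _ <-].
have hS : has_sup S by split=> //; exists M.
have le_s J : \sum_(i <- J) a i <= sup S by apply: sup_upper_bound => //; exists J.
exists (sup S); split=> //; last exact: ge_sup.
move=> e e0; have [_ [J0 _ <-] h0] := sup_adherent e0 hS.
exists J0 => J J0J; have h1 := ler_sum_fset a0 J0J; have h2 := le_s J.
rewrite -rmorph_sum -rmorphB ger0_norm ?ler0c ?subr_ge0// Re_real.
by rewrite lerBlDr addrC -lerBlDr (le_trans (ltW h0)).
Qed.

End UnorderedSums.

(** * The Hilbert space of square-summable families *)
Section SquareSummable.
Context {R : realType} {I : choiceType} {G : hilbert R}.
Implicit Types (J : {fset I}).

Definition square_summable : {pred I -> G} := fun f =>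
  `[< exists M : R, forall J, \sum_(i <- J) rnorm (f i) ^+ 2 <= M >].

Record l2 := L2 { l2_fun :> I -> G; _ : l2_fun \in square_summable }.

HB.instance Definition _ := [isSub for l2_fun].
HB.instance Definition _ := [Choice of l2 by <:].

Lemma rnorm0 {V : normedModType R[i]} : rnorm (0 : V) = 0.
Proof. by rewrite /rnorm normr0. Qed.

Lemma rnorm_sqD_le (x y : G) : rnorm (x + y) ^+ 2 <= 2 * rnorm x ^+ 2 + 2 * rnorm y ^+ 2.
Proof. by have := sqr_ge0 (rnorm (x - y)); rewrite rnorm_sqB subr_ge0. Qed.

Lemma square_summable_submod : submod_closed square_summable.
Proof.
split.
  by apply/asboolP; exists 0 => J; rewrite big1// => i _; rewrite rnorm0 expr0n.
move=> a f g /asboolP[M fM] /asboolP[N gN]; apply/asboolP.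
exists (2 * (Re (a * a^*) * M) + 2 * N) => J.
have a0 : 0 <= Re (a * a^*) by rewrite -Re_norm_sq sqr_ge0.
rewrite (le_trans (ler_sum _ (fun i _ => rnorm_sqD_le (a *: f i) (g i))))//.
rewrite big_split -!mulr_sumr /= lerD ?ler_pM2l//.
under eq_bigr do rewrite rnorm_sqZ; rewrite -mulr_sumr.
exact: ler_wpM2l.
Qed.

HB.instance Definition _ :=
  GRing.isSubmodClosed.Build R[i] (I -> G) square_summable square_summable_submod.
HB.instance Definition _ := [SubChoice_isSubLmodule of l2 by <:].

Lemma l2B (f g : l2) i : (f - g) i = f i - g i. Proof. by []. Qed.
Lemma l2_ext (f g : l2) : (forall i, f i = g i) -> f = g.
Proof. by move=> fg; apply/val_inj/funext. Qed.

Lemma l2_of (f : I -> G) (M : R) :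
  (forall J, \sum_(i <- J) rnorm (f i) ^+ 2 <= M) -> exists g : l2, forall i, g i = f i.
Proof.
move=> fM; suff fP : f \in square_summable by exists (L2 fP).
by apply/asboolP; exists M.
Qed.

Lemma l2_sums (f : l2) : exists s : R,
  has_sum (fun i => '[f i, f i]) s%:C /\ forall J, \sum_(i <- J) rnorm (f i) ^+ 2 <= s.
Proof.
case: f => f /= /asboolP[M fM].
have [s [s1 s2 _]] := nneg_has_sum (fun i => sqr_ge0 (rnorm (f i))) fM.
by exists s; split=> //; apply: has_sum_ext s1 => i; rewrite rnorm_sqC.
Qed.

Lemma polarization (x y : G) : '[x, y] = 4^-1 *
  ('[x + y, x + y] - '[x - y, x - y] + 'i * '[x + 'i *: y, x + 'i *: y]
   - 'i * '[x - 'i *: y, x - 'i *: y]).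
Proof.
rewrite !(ipDl, ipDr, ipNl, ipNr, ipZl, ipZr).
have -> : ('i : R[i])^* = - 'i by rewrite /=; apply/eqP; rewrite eq_complex /= oppr0 !eqxx.
have ii : 'i * 'i = -1 :> R[i] by rewrite -expr2 sqr_i.
apply: (@mulfI _ 4) => //; rewrite mulrA divff ?mul1r//.
ring: ii.
Qed.

(** Polarization expresses the partial sums of the inner products by partial
    sums of squares of norms, which increase and are bounded. *)
Lemma l2_ip_exists (f g : l2) : exists l : R[i], has_sum (fun i => '[f i, g i]) l.
Proof.
have [s1 [h1 _]] := l2_sums (f + g); have [s2 [h2 _]] := l2_sums (f - g).
have [s3 [h3 _]] := l2_sums (f + 'i *: g); have [s4 [h4 _]] := l2_sums (f - 'i *: g).
exists (4^-1 * (s1%:C - s2%:C + 'i * s3%:C - 'i * s4%:C)).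
apply: (@has_sum_ext _ _ (fun i => 4^-1 * ('[(f + g) i, (f + g) i] +
  (-1) * '[(f - g) i, (f - g) i] + 'i * '[(f + 'i *: g) i, (f + 'i *: g) i]
   + (- 'i) * '[(f - 'i *: g) i, (f - 'i *: g) i]))).
  by move=> i; rewrite [RHS]polarization mulN1r mulNr.
apply: has_sumZ; rewrite -[- ('i * _)]mulNr -[- s2%:C]mulN1r.
by do 2!(apply: has_sumD; last exact: has_sumZ); apply: has_sumD => //; apply: has_sumZ.
Qed.

Definition l2_ip (f g : l2) : R[i] := sval (cid (l2_ip_exists f g)).

Lemma l2_ipP (f g : l2) : has_sum (fun i => '[f i, g i]) (l2_ip f g).
Proof. exact: svalP (cid (l2_ip_exists f g)). Qed.

Lemma l2_ip_bilinear : bilinear_for (GRing.Scale.Law.clone _ _ *%R _)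
  (GRing.Scale.Law.clone _ _ (@Num.conj R[i] \; *%R) _) l2_ip.
Proof.
split=> [h|h] a f g /=.
  apply: has_sum_unique (l2_ipP _ _) _.
  apply: (@has_sum_ext _ _ (fun i => a * '[f i, h i] + '[g i, h i])).
    by move=> i; rewrite ipDl ipZl.
  by apply: has_sum_lin; exact: l2_ipP.
apply: has_sum_unique (l2_ipP _ _) _.
apply: (@has_sum_ext _ _ (fun i => a^* * '[h i, f i] + '[h i, g i])).
  by move=> i; rewrite ipDr ipZr.
by apply: has_sum_lin; exact: l2_ipP.
Qed.

HB.instance Definition _ := bilinear_isBilinear.Build R[i] l2 l2 R[i] _ _ l2_ip
  l2_ip_bilinear.

Lemma l2_ip_herm (f g : l2) : l2_ip f g = (-1) ^+ false * (l2_ip g f)^*.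
Proof.
rewrite expr0 mul1r; apply: has_sum_unique (l2_ipP _ _) _.
apply: (@has_sum_ext _ _ (fun i => '[g i, f i]^*)) => [i|]; first by rewrite -ipC.
exact/has_sum_conj/l2_ipP.
Qed.

HB.instance Definition _ := isHermitianSesquilinear.Build R[i] l2 false
  (@Num.conj R[i]) l2_ip l2_ip_herm.

End SquareSummable.
Arguments l2 {R} I G.

Section SquareSummableHilbert.
Context {R : realType} {I : choiceType} {G : hilbert R}.
Implicit Types (J : {fset I}) (f g : l2 I G).

Definition l2_norm f : R := Num.sqrt (Re (l2_ip f f)).

Lemma l2_ip_self f : [/\ l2_ip f f = (l2_norm f ^+ 2)%:C,
  forall J, \sum_(i <- J) rnorm (f i) ^+ 2 <= l2_norm f ^+ 2 &
  forall M, (forall J, \sum_(i <- J) rnorm (f i) ^+ 2 <= M) -> l2_norm f ^+ 2 <= M].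
Proof.
have h M : (forall J, \sum_(i <- J) rnorm (f i) ^+ 2 <= M) ->
    [/\ l2_ip f f = (l2_norm f ^+ 2)%:C,
  forall J, \sum_(i <- J) rnorm (f i) ^+ 2 <= l2_norm f ^+ 2 &
  l2_norm f ^+ 2 <= M].
  move=> fM.
  have [s [s1 s2 s3]] := nneg_has_sum (fun i => sqr_ge0 (rnorm (f i))) fM.
  have fs : l2_ip f f = s%:C.
    apply: has_sum_unique (l2_ipP _ _) _.
    by apply: has_sum_ext s1 => i; rewrite rnorm_sqC.
  have s0 : 0 <= s by rewrite (le_trans _ (s2 fset0))// big_nil.
  by rewrite /l2_norm fs Re_real sqr_sqrtr.
have [M [_ fM]] := l2_sums f; have [h1 h2 _] := h M fM.
by split=> // M' /h[].
Qed.

Lemma l2_norm_coord_le f i : rnorm (f i) <= l2_norm f.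
Proof.
have [_ h _] := l2_ip_self f; have := h [fset i]%fset; rewrite big_seq_fset1.
by rewrite ler_pXn2r// nnegrE ?rnorm_ge0// /l2_norm sqrtr_ge0.
Qed.

Lemma l2_ip_gt0 f : f != 0 -> 0 < l2_ip f f.
Proof.
have [-> _ _] := l2_ip_self f => f0; rewrite ltcR.
rewrite lt_def sqr_ge0 andbT; apply: contra f0.
rewrite sqrf_eq0 => /eqP f0; apply/eqP/l2_ext => i.
apply/eqP; rewrite -normr_le0 -rnormE lecR.
by rewrite -f0 l2_norm_coord_le.
Qed.

HB.instance Definition _ := isDotProduct.Build R[i] (l2 I G) l2_ip l2_ip_gt0.

Lemma l2_norm_ge0 f : 0 <= l2_norm f. Proof. exact: sqrtr_ge0. Qed.

Lemma l2_normD f g : (l2_norm (f + g))%:C <= (l2_norm f)%:C + (l2_norm g)%:C.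
Proof.
rewrite -rmorphD lecR -(ler_pXn2r (n := 2))// ?nnegrE ?addr_ge0 ?l2_norm_ge0//.
have [e1 _ _] := l2_ip_self f; have [e2 _ _] := l2_ip_self g.
have h : l2_norm (f + g) ^+ 2 = l2_norm f ^+ 2 + l2_norm g ^+ 2 + 2 * Re (l2_ip f g).
  apply: complexI; have [<- _ _] := l2_ip_self (f + g).
  have /= -> := dnormD l2_ip f g; rewrite e1 e2 !rmorphD /=; congr (_ + _).
  case: (l2_ip f g) => x y /=; apply/eqP.
  by rewrite eq_complex /= subrr eqxx andbT mulr_natl mulr2n.
have : `|Re (l2_ip f g)| <= l2_norm f * l2_norm g.
  apply: Re_le; rewrite -(@ler_pXn2r _ 2)// ?nnegrE ?ler0c ?mulr_ge0 ?l2_norm_ge0//.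
  have /= := dot_CauchySchwarz l2_ip f g; rewrite e1 e2 => h'.
  by rewrite (le_trans h')// -rmorphM -rmorphXn lecR exprMn.
rewrite h ler_norml sqrrD => /andP[_ ?]; lra.
Qed.

Lemma l2_normZ a f : (l2_norm (a *: f))%:C = `|a| * (l2_norm f)%:C.
Proof.
have h : ((l2_norm (a *: f))%:C) ^+ 2 = (`|a| * (l2_norm f)%:C) ^+ 2.
  have sq g : ((l2_norm g)%:C) ^+ 2 = l2_ip g g.
    by have [-> _ _] := l2_ip_self g; rewrite -rmorphXn.
  rewrite exprMn !sq; exact: (dnormZ l2_ip a f).
have p1 : 0 <= (l2_norm (a *: f))%:C by rewrite ler0c l2_norm_ge0.
have p2 : 0 <= `|a| * (l2_norm f)%:C by apply: mulr_ge0 => //; rewrite ler0c l2_norm_ge0.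
by apply/eqP; rewrite -(eqrXn2 (n := 2) _ p1 p2)//; apply/eqP.
Qed.

Lemma l2_norm_eq0 f : (l2_norm f)%:C = 0 -> f = 0.
Proof.
move=> f0; apply/eqP/negPn/negP => /l2_ip_gt0; have [-> _ _] := l2_ip_self f.
by rewrite rmorphXn /= f0 expr0n ltxx.
Qed.

HB.instance Definition _ :=
  Lmodule_isNormed.Build R[i] (l2 I G) l2_normD l2_normZ l2_norm_eq0.

(** A Cauchy filter converges coordinatewise to some z. Uniformity in the
    finite set J is obtained from Fatou's argument: for f close to the filter,
    the sum over J of the squares of |f i - z i| is compared with an element g
    of the filter that is close to z on J only. *)
Lemma l2_complete (F : set_system (l2 I G)) : ProperFilter F -> cauchy F -> cvg F.
Proof.
move=> FF /cauchyP cF.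
have FC (e : R) : 0 < e -> exists f, F [set g | rnorm (f - g) < e].
  move=> e0; have [|f fP] := cF e%:C; first by rewrite ltcR.
  exists f; apply: filterS fP => g; rewrite -ball_normE /ball_ /=.
  by rewrite -rnormE ltcR.
have cvgi i : exists z : G, ((fun f : l2 I G => f i) @ F) --> z.
  suff : cvg ((fun f : l2 I G => f i) @ F) by move=> /cvg_ex[z ?]; exists z.
  apply/cauchy_cvgP/cauchy_exP => e e0.
  have [e' eE e'0] := gt0_complexE e0.
  have [f fP] := FC _ e'0; exists (f i).
  apply: (@filterS _ F _ [set g | rnorm (f - g) < e']) => // g /= fg.
  rewrite -ball_normE /ball_ /= -rnormE eE ltcR.
  exact: le_lt_trans (l2_norm_coord_le (f - g) i) fg.
have /boolp.choice[z zP] := cvgi.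
have dist_z (e : R) f J : 0 < e -> F [set g | rnorm (f - g) < e] ->
    \sum_(i <- J) rnorm (f i - z i) ^+ 2 <= 4 * e ^+ 2.
  move=> e0 fP; set n : R := #|` J|%:R.
  have n0 : 0 < n + 1 by rewrite ltr_wpDl// ler0n.
  (* Small enough for the n points of J to contribute at most e ^+ 2. *)
  pose d := e / (n + 1).
  have d0 : 0 < d by rewrite divr_gt0.
  have zF i : F [set g | rnorm (g i - z i) <= d].
    have /cvgrPdist_le/(_ d%:C) := zP i; rewrite ltcR => /(_ d0).
    by apply: filterS => g /=; rewrite distrC -rnormE lecR.
  have : F [set g : l2 I G | forall i, i \in J -> rnorm (g i - z i) <= d].
    suff: forall s : seq I, F [set g : l2 I G | forall i, i \in s -> rnorm (g i - z i) <= d].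
      exact.
    elim=> [|j s IH]; first by apply: filterS filterT => g _ i; rewrite in_nil.
    apply: filterS (filterI (zF j) IH) => g [/= gj gs] i.
    by rewrite inE => /predU1P[->//|/gs].
  move=> /(filterI fP)/filter_ex[g [/= fg gz]].
  have h : \sum_(i <- J) rnorm (f i - z i) ^+ 2 <=
      \sum_(i <- J) (2 * rnorm ((f - g) i) ^+ 2 + 2 * d ^+ 2).
    rewrite big_seq [leRHS]big_seq; apply: ler_sum => i iJ.
    rewrite (_ : f i - z i = (f - g) i + (g i - z i)); last by rewrite addrA subrK.
    rewrite (le_trans (rnorm_sqD_le _ _))// lerD2l ler_pM2l//.
    by rewrite ler_pXn2r ?nnegrE ?rnorm_ge0 ?(ltW d0)//; exact: gz.
  rewrite (le_trans h)// big_split -mulr_sumr /=.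
  have [_ /(_ J) h2 _] := l2_ip_self (f - g).
  rewrite big_const_seq count_predT.
  have -> : iter (size J) (+%R (2 * d ^+ 2)) 0 = n * (2 * d ^+ 2).
    by rewrite iter_addr_0 /n [RHS]mulr_natl.
  have h3 : l2_norm (f - g) ^+ 2 <= e ^+ 2.
    by rewrite ler_pXn2r ?nnegrE ?l2_norm_ge0 ?(ltW e0)// ltW.
  have h4 : n * d ^+ 2 <= e ^+ 2.
    have de : d <= e by rewrite /d ler_pdivrMr// ler_peMr ?(ltW e0)// lerDr ler0n.
    have nd : n * d <= e.
      by rewrite /d mulrCA ger_pMr// ler_pdivrMr// mul1r lerDl.
    have n1 : 0 <= n by rewrite ler0n.
    rewrite !expr2 mulrA; apply: ler_pM => //; last exact: ltW.
    exact: mulr_ge0 n1 (ltW d0).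
  lra.
have [f1 f1P] := FC 1 ltr01.
have [w wE] := l2_of (fun J => dist_z _ _ J ltr01 f1P).
apply/cvg_ex; exists (f1 - w); apply/cvgrPdist_lt => e e0.
have [e' eE e'0] := gt0_complexE e0.
have e4 : 0 < e' / 4 by rewrite divr_gt0.
have [f fP] := FC _ e4.
apply: filterS (fP) => g /= fg; rewrite eE -rnormE ltcR.
have h : rnorm (f - (f1 - w)) <= 2 * (e' / 4).
  have p : 0 <= 2 * (e' / 4) by rewrite mulr_ge0// ltW.
  rewrite -(ler_pXn2r (n := 2))// ?nnegrE ?rnorm_ge0 ?p//.
  have [_ _] := l2_ip_self (f - (f1 - w)); apply => J.
  rewrite exprMn (_ : 2 ^+ 2 = 4); last by rewrite expr2; lra.
  rewrite (le_trans _ (dist_z _ _ J e4 fP))//.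
  apply: ler_sum => i _; rewrite !l2B wE.
  by rewrite (_ : f1 i - _ = z i)// opprB addrC subrK.
rewrite (_ : f1 - w - g = (f - g) - (f - (f1 - w))); last first.
  by rewrite opprB [RHS]addrC addrA subrK.
rewrite (le_lt_trans (rnormD _ _))// rnormN; lra.
Qed.

HB.instance Definition _ := Uniform_isComplete.Build (l2 I G) l2_complete.

Lemma l2_normE f : `|f| ^+ 2 = l2_ip f f.
Proof. by have [-> _ _] := l2_ip_self f; rewrite rmorphXn. Qed.

Definition l2_hilbert : hilbert R := @Hilbert R (l2 I G) l2_ip l2_normE.

End SquareSummableHilbert.
Arguments l2_hilbert {R} I G.

(** * Coordinates, amplifications and columns *)
Section Columns.
Context {R : realType} {I : choiceType} {G : hilbert R}.
Local Notation K := (l2_hilbert I G).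
Implicit Types (i j : I) (J : {fset I}) (z w : K) (a b c : 'B(G)).

Lemma l2_coord_exists i : exists T : blin K G, forall z : K, T z = (z : l2 I G) i.
Proof.
apply: (@blin_of _ _ _ _ 1) => [//|z].
by rewrite mul1r; exact: l2_norm_coord_le.
Qed.

Definition l2_coord i : blin K G := sval (cid (l2_coord_exists i)).

Lemma l2_coordE i (z : l2 I G) : l2_coord i (z : K) = z i.
Proof. exact: (svalP (cid (l2_coord_exists i))). Qed.

Lemma l2_coord_ext z w : (forall i, l2_coord i z = l2_coord i w) -> z = w.
Proof. by move=> zw; apply: l2_ext => i; rewrite -!l2_coordE. Qed.

Lemma l2_with_coords (f : I -> G) (M : R) :
  (forall J, \sum_(i <- J) rnorm (f i) ^+ 2 <= M) -> exists z, forall i, l2_coord i z = f i.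
Proof. by move=> /l2_of[z zf]; exists z => i; rewrite l2_coordE. Qed.

Lemma ip_has_sum z w : has_sum (fun i => '[l2_coord i z, l2_coord i w]) '[z, w].
Proof.
by apply: has_sum_ext (l2_ipP (z : l2 I G) w) => i; rewrite !l2_coordE.
Qed.

Lemma sum_coord_le z J : \sum_(i <- J) rnorm (l2_coord i z) ^+ 2 <= rnorm z ^+ 2.
Proof.
have [_ h _] := l2_ip_self (z : l2 I G).
by under eq_bigr do rewrite l2_coordE; exact: h.
Qed.

Lemma rnorm_sq_le z (M : R) :
  (forall J, \sum_(i <- J) rnorm (l2_coord i z) ^+ 2 <= M) -> rnorm z ^+ 2 <= M.
Proof.
have [_ _ h] := l2_ip_self (z : l2 I G) => zM; apply: h => J.
by under eq_bigr do rewrite -l2_coordE.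
Qed.

Lemma l2_single_exists i : exists T : blin G K, forall y j,
  l2_coord j (T y) = if j == i then y else 0.
Proof.
have /boolp.choice[s sP] : forall y : G, exists z,
    (forall j, l2_coord j z = if j == i then y else 0) /\ rnorm z <= 1 * rnorm y.
  move=> y; have h J : \sum_(j <- J) rnorm (if j == i then y else 0) ^+ 2 <= rnorm y ^+ 2.
    have [iJ|iJ] := boolP (i \in J).
      rewrite (big_fsetD1 i)//= eqxx big1_fset ?addr0// => j.
      by rewrite !inE => /andP[/negPf-> _] _; rewrite rnorm0 expr0n.
    rewrite big1_fset ?sqr_ge0// => j jJ _; case: eqP => [ji|_].
      by rewrite -ji jJ in iJ.
    by rewrite rnorm0 expr0n.
  have [z zP] := l2_with_coords h; exists z; split=> //.
  rewrite mul1r -(ler_pXn2r (n := 2))// ?nnegrE ?rnorm_ge0//.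
  by apply: rnorm_sq_le => J; under eq_bigr do rewrite zP.
have [||T TP] := @blin_of _ _ _ s 1.
- move=> u x y; apply: l2_coord_ext => j; rewrite linearP /= !(sP _).1.
  by case: eqP => // _; rewrite scaler0 addr0.
- by move=> y; exact: (sP y).2.
by exists T => y j; rewrite TP (sP y).1.
Qed.

Definition l2_single i : blin G K := sval (cid (l2_single_exists i)).

Lemma coord_single i y j : l2_coord j (l2_single i y) = if j == i then y else 0.
Proof. exact: (svalP (cid (l2_single_exists i))). Qed.

Lemma ip_l2_single i y z : '[l2_single i y, z] = '[y, l2_coord i z].
Proof.
apply: has_sum_unique (ip_has_sum _ _) _ => e e0; exists [fset i]%fset => J iJ.
have {}iJ : i \in J by apply: (fsubsetP iJ); rewrite inE.
have -> : \sum_(j <- J) '[l2_coord j (l2_single i y), l2_coord j z] = '[y, l2_coord i z].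
  rewrite (big_fsetD1 i)//= coord_single eqxx big1_fset ?addr0// => j.
  by rewrite !inE coord_single => /andP[/negPf-> _] _; rewrite ip0l.
by rewrite subrr normr0 Re_real ltW.
Qed.

Lemma coord_sum_single z J j :
  l2_coord j (\sum_(i <- J) l2_single i (l2_coord i z)) = if j \in J then l2_coord j z else 0.
Proof.
rewrite linear_sum /=; have [jJ|jJ] := boolP (j \in J).
  rewrite (big_fsetD1 j)//= coord_single eqxx big1_fset ?addr0// => i.
  by rewrite !inE coord_single eq_sym => /andP[/negPf-> _].
rewrite big1_fset// => i iJ _; rewrite coord_single; case: eqP => // ji.
by rewrite ji iJ in jJ.
Qed.

Lemma sum_l2_single_cvg z (e : R) : 0 < e -> exists J0, forall J, (J0 `<=` J)%fset ->
  rnorm (z - \sum_(i <- J) l2_single i (l2_coord i z)) <= e.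
Proof.
move=> e0; have [J0 h0] := ip_has_sum z z (exprn_gt0 2 e0).
exists J0 => J J0J.
rewrite -(ler_pXn2r (n := 2))// ?nnegrE ?rnorm_ge0 ?(ltW e0)//.
have := h0 J J0J; set s := \sum_(i <- J) l2_single i _.
have -> : \sum_(i <- J) '[l2_coord i z, l2_coord i z] = '[s, s].
  rewrite {1}/s ip_suml big_seq [RHS]big_seq; apply: eq_bigr => i iJ.
  by rewrite ip_l2_single /s coord_sum_single iJ.
have zs : '[z, s] = '[s, s].
  rewrite {1 3}/s !ip_sumr big_seq [RHS]big_seq; apply: eq_bigr => i iJ.
  by rewrite ipC ip_l2_single [RHS]ipC ip_l2_single /s coord_sum_single iJ.
have -> : '[z, z] - '[s, s] = '[z - s, z - s].
  by rewrite ipBl !ipBr zs [ '[s, z] ]ipC zs -ipC subrr subr0.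
by rewrite -rnorm_sqC ger0_norm ?Re_real// ler0c sqr_ge0.
Qed.

Lemma amp_exists c : exists T : blin K K, forall z i, l2_coord i (T z) = c (l2_coord i z).
Proof.
have [M M0 cM] := blin_rnorm_bound c.
have /boolp.choice[s sP] : forall z : K, exists w,
    (forall i, l2_coord i w = c (l2_coord i z)) /\ rnorm w <= M * rnorm z.
  move=> z; have h J : \sum_(j <- J) rnorm (c (l2_coord j z)) ^+ 2 <= (M * rnorm z) ^+ 2.
    rewrite exprMn (le_trans (ler_sum _ (_ : forall j, true ->
      _ <= (M * rnorm (l2_coord j z)) ^+ 2)))//.
      by move=> j _; rewrite ler_pXn2r// ?nnegrE ?mulr_ge0 ?rnorm_ge0.
    under eq_bigr do rewrite exprMn; rewrite -mulr_sumr.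
    by rewrite ler_wpM2l ?sqr_ge0// sum_coord_le.
  have [w wP] := l2_with_coords h; exists w; split=> //.
  rewrite -(ler_pXn2r (n := 2))// ?nnegrE ?rnorm_ge0 ?mulr_ge0 ?rnorm_ge0//.
  by apply: rnorm_sq_le => J; under eq_bigr do rewrite wP.
have [||T TP] := @blin_of _ _ _ s M.
- by move=> u x y; apply: l2_coord_ext => j; rewrite linearP /= !(sP _).1 !linearP.
- by move=> y; exact: (sP y).2.
by exists T => y j; rewrite TP (sP y).1.
Qed.

(** The operator c on every coordinate, that is, c (x) 1 on G (x) l2(I). *)
Definition amp c : 'B(K) := sval (cid (amp_exists c)).

Lemma coord_amp c z i : l2_coord i (amp c z) = c (l2_coord i z).
Proof. exact: (svalP (cid (amp_exists c))). Qed.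

Lemma ampM a b z : amp (a * b) z = amp a (amp b z).
Proof. by apply: l2_coord_ext => i; rewrite !coord_amp. Qed.

Lemma amp1 z : amp 1 z = z.
Proof. by apply: l2_coord_ext => i; rewrite !coord_amp. Qed.

Lemma amp_adj c z w : '[amp c z, w] = '[z, amp (adj c) w].
Proof.
apply: has_sum_unique (ip_has_sum _ _) _.
apply: has_sum_ext (ip_has_sum z (amp (adj c) w)) => i.
by rewrite !coord_amp adj_adjoint -adjointE.
Qed.

Lemma column_exists (D : I -> 'B(G)) (M : R) :
  (forall J x, \sum_(i <- J) rnorm (D i x) ^+ 2 <= M * rnorm x ^+ 2) ->
  exists V : blin G K, forall i x, l2_coord i (V x) = D i x.
Proof.
move=> DM.
have /boolp.choice[s sP] : forall x : G, exists w,
    (forall i, l2_coord i w = D i x) /\ rnorm w <= Num.sqrt M * rnorm x.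
  move=> x; have [w wP] := l2_with_coords (DM^~ x); exists w; split=> //.
  have [M0|M0] := leP 0 M.
    rewrite -(ler_pXn2r (n := 2))// ?nnegrE ?rnorm_ge0 ?mulr_ge0 ?rnorm_ge0 ?sqrtr_ge0//.
    rewrite exprMn (sqr_sqrtr M0); apply: rnorm_sq_le => J.
    by under eq_bigr do rewrite wP.
  rewrite ltr0_sqrtr// mul0r.
  have /rnorm_sq_le : forall J, \sum_(i <- J) rnorm (l2_coord i w) ^+ 2 <= 0.
    move=> J; under eq_bigr do rewrite wP.
    by rewrite (le_trans (DM J x))// mulr_le0_ge0// ?sqr_ge0// ltW.
  by rewrite -[X in _ <= X](expr0n R 2) ler_pXn2r ?nnegrE ?rnorm_ge0.
have [||T TP] := @blin_of _ _ _ s (Num.sqrt M).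
- by move=> u x y; apply: l2_coord_ext => j; rewrite linearP /= !(sP _).1 !linearP.
- by move=> y; exact: (sP y).2.
by exists T => j y; rewrite TP (sP y).1.
Qed.

Lemma partial_sumE (F : I -> 'B(G)) J x : partial_sum F J x = \sum_(i <- J) F i x.
Proof.
rewrite /partial_sum -(big_seq_fsetE _ _ predT F) /=.
by elim/big_rec2: _ => [//|i y T _ <-].
Qed.

Lemma strong_sum_ip (F : I -> 'B(G)) S x y :
  strong_sum F S -> has_sum (fun i => '[F i x, y]) '[S x, y].
Proof.
move=> /(_ x) /cvgrPdist_le FS e e0.
have c0 : 0 < rnorm y + 1 by rewrite ltr_wpDl ?rnorm_ge0.
have e1 : 0 < e / (rnorm y + 1) by rewrite divr_gt0.
have [|J0 _ h] := FS (@totally_filter I) (e / (rnorm y + 1))%:C; first by rewrite ltcR.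
exists J0 => J /h /=; rewrite partial_sumE -ip_suml -ipBl -rnormE lecR => h1.
rewrite -lecR normC_Re (le_trans (ip_le _ _))// -!rnormE -rmorphM lecR.
rewrite (le_trans (ler_wpM2r (rnorm_ge0 _) h1))// -mulrA ger_pMr//.
by rewrite ler_pdivrMl// mulr1 lerDl.
Qed.

End Columns.

(** * The involution of bounded operators and maximal abelian algebras *)
Section AdjointAlgebra.
Context {R : realType} {G : hilbert R}.
Implicit Types (a b c h u : 'B(G)).

Lemma blinM a b x : (a * b) x = a (b x). Proof. by []. Qed.
Lemma blin1 (x : G) : (1 : 'B(G)) x = x. Proof. by []. Qed.
Lemma blinB {V W : normedModType R[i]} (a b : blin V W) (x : V) : (a - b) x = a x - b x.
Proof. by []. Qed.
Lemma blinN {V W : normedModType R[i]} (a : blin V W) (x : V) : (- a) x = - a x.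
Proof. by []. Qed.
Lemma blin0 {V W : normedModType R[i]} (x : V) : (0 : blin V W) x = 0. Proof. by []. Qed.
Lemma blinZAl (z : R[i]) a b : z *: a * b = z *: (a * b).
Proof. exact: blin_ext. Qed.
Lemma blinZAr (z : R[i]) a b : a * (z *: b) = z *: (a * b).
Proof. by apply: blin_ext => x; rewrite blinM !blinZ linearZ. Qed.

Lemma adjE a x y : '[a x, y] = '[x, adj a y].
Proof. by rewrite adj_adjoint adjointE. Qed.
Lemma adjEl a x y : '[adj a x, y] = '[x, a y].
Proof. by rewrite adj_adjoint adjointEl. Qed.

Lemma adj_unique a b : (forall x y, '[a x, y] = '[x, b y]) -> adj a = b.
Proof. by rewrite adj_adjoint; exact: adjoint_unique. Qed.

Lemma adjK a : adj (adj a) = a.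
Proof. by apply: adj_unique => x y; rewrite adjEl. Qed.
Lemma adjM a b : adj (a * b) = adj b * adj a.
Proof. by apply: adj_unique => x y; rewrite !blinM !adjE. Qed.
Lemma adj1 : adj (1 : 'B(G)) = 1.
Proof. by apply: adj_unique. Qed.
Lemma adjD a b : adj (a + b) = adj a + adj b.
Proof. by apply: adj_unique => x y; rewrite !blinD ipDl ipDr !adjE. Qed.
Lemma adjZ z a : adj (z *: a) = z^* *: adj a.
Proof. by apply: adj_unique => x y; rewrite !blinZ ipZl ipZr conjCK adjE. Qed.
Lemma adjN a : adj (- a) = - adj a.
Proof. by apply: adj_unique => x y; rewrite !blinN ipNl ipNr adjE. Qed.
Lemma adjB a b : adj (a - b) = adj a - adj b.
Proof. by rewrite adjD adjN. Qed.

Definition unitary u := adj u * u = 1 /\ u * adj u = 1.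

Lemma unitary_rnorm u x : unitary u -> rnorm (u x) = rnorm x.
Proof.
move=> [uu _]; apply/eqP; rewrite -(eqrXn2 (n := 2)) ?rnorm_ge0//; apply/eqP.
by rewrite !rnorm_sq adjE -blinM uu.
Qed.

Lemma unitary_adj u : unitary u -> unitary (adj u).
Proof. by move=> [u1 u2]; split; rewrite adjK. Qed.

Lemma unitaryM u v : unitary u -> unitary v -> unitary (u * v).
Proof.
move=> [u1 u2] [v1 v2]; split; rewrite adjM.
  by rewrite -mulrA [_ * (u * v)]mulrA u1 mul1r.
by rewrite -mulrA [v * _]mulrA v2 mul1r.
Qed.

Lemma unitary1 : unitary 1.
Proof. by split; rewrite adj1 mulr1. Qed.

Section Masa.
Variables (C : set 'B(G)).
Hypothesis masaC : masa C.

Lemma masa_adj a : C a -> C (adj a).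
Proof. by case: masaC => [[_ h _] _ _ _]; exact: h. Qed.
Lemma masa1 : C 1. Proof. by case: masaC. Qed.
Lemma masa_comm a b : C a -> C b -> a * b = b * a.
Proof. by case: masaC => [_ _ h _]; exact: h. Qed.
Lemma masa_lin z a b : C a -> C b -> C (z *: a + b).
Proof. by case: masaC => [[[_ h _] _ _] _ _ _]; exact: h. Qed.
Lemma masa0 : C 0. Proof. by case: masaC => [[[]]]. Qed.
Lemma masaM a b : C a -> C b -> C (a * b).
Proof. by case: masaC => [[[_ _ h] _ _] _ _ _]; exact: h. Qed.
Lemma masaZ z a : C a -> C (z *: a).
Proof. by move=> Ca; rewrite -[_ *: _]addr0; apply: masa_lin => //; exact: masa0. Qed.
Lemma masaD a b : C a -> C b -> C (a + b).
Proof. by move=> Ca Cb; rewrite -[a]scale1r; exact: masa_lin. Qed.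
Lemma masaN a : C a -> C (- a).
Proof. by rewrite -scaleN1r; exact: masaZ. Qed.
Lemma masaB a b : C a -> C b -> C (a - b).
Proof. by move=> Ca Cb; apply: masaD => //; exact: masaN. Qed.

(** Maximality is a statement about commutative subalgebras. It applies to the
    bicommutant D of C and a: D commutes with the commutant of C and a, which
    contains C and a, hence contains D. *)
Lemma masa_commutant a : (forall c, C c -> a * c = c * a) -> C a.
Proof.
move=> aC; pose S := C `|` [set a].
have SS (x y : 'B(G)) : S x -> S y -> x * y = y * x.
  move=> [Cx|->] [Cy|->]//; [exact: masa_comm|by rewrite aC|by rewrite aC].
pose S' := [set x : 'B(G) | forall s, S s -> s * x = x * s].
pose D := [set b : 'B(G) | forall x, S' x -> b * x = x * b].
have SD : S `<=` D by move=> s Ss x /(_ s Ss).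
have <- : D = C.
  case: masaC => [_ _ _]; apply.
  - split; first by move=> x _; rewrite mul0r mulr0.
      by move=> z b b' Db Db' x xS; rewrite mulrDl mulrDr blinZAl blinZAr Db// Db'.
    by move=> b b' Db Db' x xS; rewrite -mulrA Db'// mulrA Db// mulrA.
  - move=> b b' Db Db'; apply: Db => s Ss; apply/esym; apply: Db' => s' Ss'.
    exact: SS.
  - by move=> c Cc; apply: SD; left.
by apply: SD; right.
Qed.

(** For t = i or - i the two mixed terms in |(h + t) x|^2 cancel, so that h + t
    is bounded below and the inverse of its graph is a bounded relation. *)
Lemma resolvent_left h (t : R[i]) : adj h = h -> t^* = - t -> t * t^* = 1 ->
  exists q, q * (h + t *: (1 : 'B(G))) = 1.
Proof.
move=> hh tt t1; pose p := h + t *: (1 : 'B(G)).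
have pn x : rnorm x <= 1 * rnorm (p x).
  rewrite mul1r -(ler_pXn2r (n := 2))// ?nnegrE ?rnorm_ge0//.
  suff -> : rnorm (p x) ^+ 2 = rnorm (h x) ^+ 2 + rnorm x ^+ 2 by rewrite lerDr sqr_ge0.
  rewrite !rnorm_sq -Re_add; congr (Re _); rewrite /p blinD blinZ blin1.
  have hs : '[h x, x] = '[x, h x] by rewrite adjE hh.
  rewrite ipDl !ipDr !ipZl !ipZr hs tt.
  rewrite [t * (- t * _)]mulrA -tt t1 tt; ring.
have [||||T [TP _ _ _]] := @relation_extension _ G G (fun y x => y = p x) 1.
- exact: ler01.
- by rewrite linear0.
- by move=> z p1 q1 p2 q2 -> ->; rewrite linearP.
- by move=> _ x ->.
by exists T; apply: blin_ext => x; rewrite blinM (TP _ x).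
Qed.

(** The Cayley transform u = (h - i) (h + i)^-1. The commutant of u determines
    that of h because (1 - u) (h + i) = 2 i = (h + i) (1 - u). *)
Lemma cayley h : C h -> adj h = h ->
  exists u, [/\ C u, unitary u & forall b, b * u = u * b -> b * h = h * b].
Proof.
move=> Ch hh; set t : R[i] := 'i.
have tt : t^* = - t by rewrite /=; apply/eqP; rewrite eq_complex /= oppr0 !eqxx.
have t1 : t * t^* = 1 by rewrite tt mulrN -expr2 sqr_i opprK.
(* The left inverses of p = h + i and of m = adj p = h - i are adjoint to each
   other, hence also right inverses. *)
have [q qp] := resolvent_left hh tt t1.
have [|| q' q'm] := @resolvent_left h (- t) hh; first by rewrite rmorphN; congr (- _); exact: tt.
  by rewrite [(- t)^*]rmorphN mulrNN; exact: t1.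
set p := h + t *: (1 : 'B(G)) in qp; set m := h + - t *: (1 : 'B(G)) in q'm.
have adjp : adj p = m by rewrite /p /m adjD adjZ adj1 hh tt.
have adjm : adj m = p by rewrite -adjp adjK.
have pq' : m * adj q = 1 by rewrite -adjp -adjM qp adj1.
have q'E : q' = adj q by rewrite -[LHS]mulr1 -pq' mulrA q'm mul1r.
have pq : p * q = 1 by rewrite -(adjK p) -(adjK q) -adjM adjp -q'E q'm adj1.
have Cp : C p by apply: masaD => //; apply: masaZ; exact: masa1.
have Cm : C m by apply: masaD => //; apply: masaZ; exact: masa1.
have Cq : C q.
  apply: masa_commutant => c Cc.
  rewrite -[q * c]mulr1 -pq !mulrA -[q * c * p]mulrA (masa_comm Cc Cp).
  by rewrite mulrA qp mul1r.
exists (m * q); split; first exact: masaM.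
  split; rewrite adjM adjm.
    rewrite -!mulrA [p * _]mulrA (masa_comm Cp Cm) -mulrA pq mulr1.
    by rewrite -q'E q'm.
  have Cq' : C (adj q) by exact: masa_adj.
  by rewrite -!mulrA [q * _]mulrA (masa_comm Cq Cq') !mulrA pq' mul1r qp.
move=> b bu; have E : p - m * q * p = (2 * t) *: (1 : 'B(G)).
  rewrite -mulrA qp mulr1 /p /m scaleNr opprB addrC addrA subrK -scalerDl.
  by rewrite mulr_natl mulr2n.
have E' : p - p * (m * q) = (2 * t) *: (1 : 'B(G)).
  by rewrite (masa_comm Cp (masaM Cm Cq)).
have t0 : 2 * t != 0.
  by rewrite mulf_neq0 ?pnatr_eq0// eq_complex /= oner_eq0 andbF.
have bp : b * p = p * b.
  apply: (@scalerI _ _ (2 * t) t0).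
  have -> : (2 * t) *: (b * p) = p * b * p - p * (m * q * b) * p.
    by rewrite -[b * p]mul1r -blinZAl -E' mulrBl !mulrA.
  have -> : (2 * t) *: (p * b) = p * b * p - p * (b * (m * q)) * p.
    by rewrite -{1}[p * b]mulr1 -blinZAr -E mulrBr !mulrA.
  by rewrite bu.
move: bp; rewrite /p mulrDl mulrDr blinZAl blinZAr mulr1 mul1r.
exact: addIr.
Qed.

(** Every element of C is a combination of two selfadjoint ones, and these are
    controlled by their Cayley transforms. *)
Lemma masa_unitary_commutant b :
  (forall u, C u -> unitary u -> b * u = u * b) -> C b.
Proof.
move=> bU; apply: masa_commutant => c Cc.
have bh h : C h -> adj h = h -> b * h = h * b.
  by move=> Ch /(cayley Ch)[u [Cu uu]]; apply; exact: bU.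
have h1 : b * (c + adj c) = (c + adj c) * b.
  apply: bh; first by apply: masaD => //; exact: masa_adj.
  by rewrite adjD adjK addrC.
have h2 : b * ('i *: (c - adj c)) = 'i *: (c - adj c) * b.
  apply: bh; first by apply/masaZ/masaB => //; exact: masa_adj.
  rewrite adjZ adjB adjK -opprB scalerN -scaleNr; congr (_ *: _).
  by rewrite /=; apply/eqP; rewrite eq_complex /= oppr0 opprK !eqxx.
have h3 : b * (c - adj c) = (c - adj c) * b.
  move: h2; rewrite blinZAl blinZAr; apply: scalerI.
  by rewrite eq_complex /= oner_eq0 andbF.
have : b * (2%:R *: c) = (2%:R *: c) * b.
  rewrite (_ : 2%:R *: c = (c + adj c) + (c - adj c)); last first.
    by rewrite addrACA subrr addr0 scaler_nat mulr2n.
  by rewrite mulrDr h1 h3 [RHS]mulrDl.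
by rewrite blinZAl blinZAr; apply: scalerI; rewrite pnatr_eq0.
Qed.

End Masa.
End AdjointAlgebra.

(** * Composition of operators between different spaces *)
Section BlinLinear.
Context {R : realType} {V W : normedModType R[i]}.
Implicit Types (f : blin V W).
Lemma blin_add f x y : f (x + y) = f x + f y. Proof. exact: linearD. Qed.
Lemma blin_sub f x y : f (x - y) = f x - f y. Proof. exact: linearB. Qed.
Lemma blin_zero f : f 0 = 0. Proof. exact: linear0. Qed.
Lemma blin_scale f a x : f (a *: x) = a *: f x. Proof. exact: linearZ. Qed.
Lemma blin_sum f (J : Type) (r : seq J) (F : J -> V) :
  f (\sum_(j <- r) F j) = \sum_(j <- r) f (F j).
Proof. exact: linear_sum. Qed.
End BlinLinear.

Section Bcomp.
Context {R : realType} {U V W : normedModType R[i]}.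

Lemma bcomp_exists (f : blin V W) (g : blin U V) : exists T : blin U W, forall x, T x = f (g x).
Proof.
have [M M0 fM] := blin_rnorm_bound f; have [N N0 gN] := blin_rnorm_bound g.
apply: (@blin_of _ _ _ _ (M * N)) => [a x y|x]; first by rewrite !linearP.
by rewrite (le_trans (fM _))// -mulrA ler_wpM2l.
Qed.

(** The product of [blin V V] covers only operators on one space. *)
Definition bcomp (f : blin V W) (g : blin U V) : blin U W := sval (cid (bcomp_exists f g)).

Lemma bcompE f g x : bcomp f g x = f (g x).
Proof. exact: (svalP (cid (bcomp_exists f g))). Qed.

End Bcomp.

(** * Log-convex sequences, and averages over abelian semigroups *)
(** The ratios a (k + 1) / a k increase. If the first one exceeded 2 (M + 1),
    then a k would outgrow A * M ^ k. *)
Lemma log_convex_bound (R : realType) (a : nat -> R) (A M : R) :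
  (forall k, 0 <= a k) -> 0 <= M -> (forall k, a k.+1 ^+ 2 <= a k * a k.+2) ->
  (forall k, a k <= A * M ^+ k) -> a 1 <= 2 * (M + 1) * a 0.
Proof.
move=> a0 M0 lc aA; rewrite leNgt; apply/negP.
set r := 2 * (M + 1) => a1.
have r0 : 0 < r by rewrite mulr_gt0// ltr_wpDl.
have p0 : 0 < a 0.
  rewrite lt_def a0 andbT; apply/negP => /eqP z; have := lc 0.
  by rewrite z mul0r leNgt exprn_gt0//; move: a1; rewrite z mulr0.
have ak k : 0 < a k /\ r * a k <= a k.+1.
  elim: k => [|k [pk IH]]; first by split=> //; exact: ltW.
  have pk1 : 0 < a k.+1 by rewrite (lt_le_trans _ IH)// mulr_gt0.
  split=> //; rewrite -(ler_pM2l pk) (le_trans _ (lc k))// expr2 mulrCA mulrA.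
  by rewrite ler_pM2r.
have rk k : r ^+ k * a 0 <= a k.
  elim: k => [|k IH]; first by rewrite mul1r.
  by rewrite exprS -mulrA (le_trans _ (ak k).2)// ler_pM2l.
have A0 : 0 <= A by have := aA 0; rewrite mulr1; apply: le_trans; exact: ltW.
have M1 : 0 < M + 1 by rewrite ltr_wpDl.
have bound k : 2 ^+ k * a 0 <= A.
  rewrite -(ler_pM2l (exprn_gt0 k M1)).
  rewrite mulrA -exprMn [(M + 1) * 2]mulrC (le_trans (rk k))// (le_trans (aA k))//.
  by rewrite mulrC ler_wpM2r// lerXn2r ?nnegrE ?lerDl// ltW.
have [k kP] : exists k : nat, A / a 0 < k%:R.
  by exists (Num.bound (A / a 0)); rewrite archi_boundP// divr_ge0// ltW.
have := bound k; rewrite -ler_pdivlMr// leNgt => /negP; apply.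
rewrite (lt_le_trans kP)// -natrX ler_nat ltnW//; exact: ltn_expl.
Qed.

Section Folner.
Context {R : realType} {W : normedModType R[i]}.
Variables (T : Type) (mul : T -> T -> T) (one : T).
Hypotheses (mulA : associative mul) (mulC : commutative mul).

Lemma ler_rnorm_sum (J : Type) (r : seq J) (F : J -> W) :
  rnorm (\sum_(j <- r) F j) <= \sum_(j <- r) rnorm (F j).
Proof.
elim/big_rec2: _ => [|j y x _ IH]; first by rewrite /rnorm normr0.
by rewrite (le_trans (rnormD _ _))// lerD2l.
Qed.

(** Abelian semigroups are amenable: a finite family gs is almost invariant
    under every u in us, in the sense that averages over gs of a bounded
    function hardly change under translation by u. For one more generator u,
    replace gs by its translates by 1, u, ..., u^(n - 1); the sum along each
    orbit telescopes. *)
Lemma folner (us : seq T) (B e : R) : 0 <= B -> 0 < e -> exists gs : seq T,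
  (0 < size gs)%N /\ forall F : T -> W, (forall g, rnorm (F g) <= B) ->
  \big[and/True]_(u <- us)
    (rnorm (\sum_(g <- gs) (F (mul g u) - F g)) <= e * (size gs)%:R).
Proof.
move=> B0 e0; elim: us => [|u us [gs [gs0 IH]]].
  by exists [:: one]; split=> // F FB; rewrite big_nil.
pose pw k := iter k (mul u) one.
have pwS g k : mul (mul g (pw k)) u = mul g (pw k.+1).
  by rewrite -mulA /= [mul (pw k) u]mulC.
have [n nP] : exists n : nat, 2 * B / e < n%:R.
  exists (Num.bound (2 * B / e)); rewrite archi_boundP// divr_ge0// ?mulr_ge0//.
  exact: ltW.
have n0 : (0 < n)%N.
  by rewrite -(ltr_nat R) (le_lt_trans _ nP)// divr_ge0// ?mulr_ge0// ltW.
exists [seq mul g (pw k) | g <- gs, k <- iota 0 n]; split.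
  by rewrite size_allpairs size_iota muln_gt0 gs0.
move=> F FB; rewrite big_cons size_allpairs size_iota natrM; split.
  rewrite big_allpairs_dep (le_trans (ler_rnorm_sum _ _))//.
  have le2B g : rnorm (\sum_(k <- iota 0 n) (F (mul (mul g (pw k)) u) - F (mul g (pw k))))
      <= e * n%:R.
    under eq_bigr do rewrite pwS.
    rewrite -[n in iota _ n]subn0 (telescope_sumr (fun k => F (mul g (pw k))))//.
    rewrite (le_trans (rnormD _ _))// rnormN.
    have : 2 * B <= e * n%:R by rewrite [e * _]mulrC -ler_pdivrMr// ltW.
    apply: le_trans; rewrite mulr_natl mulr2n; exact: lerD.
  rewrite (le_trans (ler_sum _ (fun g _ => le2B g)))//.
  by rewrite big_const_seq count_predT iter_addr_0 -[leLHS]mulr_natr mulrAC -mulrA.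
have H k := IH (fun g => F (mul g (pw k))) (fun g => FB _).
elim: us {IH} H => [|v us IH] H; first by rewrite !big_nil.
rewrite big_cons; split; last by apply: IH => k; have := H k; rewrite big_cons => -[].
rewrite big_allpairs_dep exchange_big /= (le_trans (ler_rnorm_sum _ _))//.
have le1 k : rnorm (\sum_(g <- gs) (F (mul (mul g (pw k)) v) - F (mul g (pw k))))
    <= e * (size gs)%:R.
  have := H k; rewrite big_cons => -[+ _].
  by under eq_bigr do rewrite -mulA [mul v _]mulC mulA.
rewrite (le_trans (ler_sum _ (fun k _ => le1 k)))//.
by rewrite big_const_seq count_predT size_iota iter_addr_0 -[leLHS]mulr_natr -mulrA.
Qed.

End Folner.

(** * The derivation and its right action *)
Section Necessity.
Context {R : realType} {I : choiceType} {G : hilbert R}.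
Local Notation K := (l2_hilbert I G).
Variables (C : set 'B(G)) (masaC : masa C) (V : blin G K) (L : 'B(G) -> 'B(G)) (beta : 'B(G)).
Hypothesis (LE : forall b x y,
  '[amp b (V x), V y] = '[L b x, y] - '[beta x, adj b y] - '[b x, beta y]).
Hypothesis (LC : forall c, C c -> C (L c)).

Let CT := {c : 'B(G) | C c}.

(** The derivation c |-> amp c o V - V o c into the operators from G to K. *)
Definition delta (a : 'B(G)) : blin G K := bcomp (amp a) V - bcomp V a.

Arguments delta a : simpl never.

Lemma deltaE a x : delta a x = amp a (V x) - V (a x).
Proof. by rewrite /delta blinB !bcompE. Qed.

Lemma delta_cocycle a b x : delta (a * b) x = amp a (delta b x) + delta a (b x).
Proof. by rewrite !deltaE ampM linearB /= addrA subrK. Qed.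

(** The terms with beta cancel, so that the inner products of the derivation are
    given by L alone, and by elements of C. *)
Lemma delta_ip a b : C a -> C b ->
  exists2 g, C g & forall x y, '[delta a x, delta b y] = '[g x, y].
Proof.
move=> Ca Cb; have Cb' := masa_adj masaC Cb.
exists (L (adj b * a) - adj b * L a - L (adj b) * a + adj b * L 1 * a).
  have C1 := masa1 masaC.
  apply: masaD => //; last by do !apply: masaM => //; exact: LC.
  apply: masaB => //; last by apply: masaM => //; exact: LC.
  by apply: masaB => //; [apply: LC|]; apply: masaM => //; exact: LC.
move=> x y; rewrite !deltaE ipBl !ipBr.
have -> : '[amp a (V x), amp b (V y)] = '[amp (adj b * a) (V x), V y].
  by rewrite ampM [RHS]amp_adj adjK.
have -> : '[V (a x), amp b (V y)] = '[amp (adj b) (V (a x)), V y].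
  by rewrite [RHS]amp_adj adjK.
rewrite -[in '[V (a x), V (b y)]](amp1 (V (a x))) !LE.
rewrite !blinD !blinN !blinM !blin1 !ipDl !ipNl !adjM adj1 !adjK.
rewrite !blinM !blin1 !adjEl; ring.
Qed.

(** This is where commutativity of C enters: c in C can be moved from one factor
    of the inner product to the other on the right hand side of delta. *)
Lemma delta_move a b f x y : C a -> C b -> C f ->
  '[delta a (f x), delta b y] = '[delta a x, delta b (adj f y)].
Proof.
move=> Ca Cb Cf; have [g Cg gP] := delta_ip Ca Cb.
by rewrite !gP -blinM (masa_comm masaC Cg Cf) blinM adjE.
Qed.

(** Vectors in the span of the delta a x are written with coefficients (a, x);
    the argument d is applied to all the x, so that changing d is the right
    action, before it is known to be well defined. *)
Definition delta_sum (s : seq (CT * G)) (d : 'B(G)) : K :=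
  \sum_(p <- s) delta (sval p.1) (d p.2).

Lemma delta_sum_move s t f d e : C f ->
  '[delta_sum s (f * d), delta_sum t e] = '[delta_sum s d, delta_sum t (adj f * e)].
Proof.
move=> Cf; rewrite /delta_sum !ip_suml; apply: eq_bigr => p _.
rewrite !ip_sumr; apply: eq_bigr => q _.
by rewrite !blinM delta_move//; exact: svalP.
Qed.

Lemma delta_sum_cat s t d : delta_sum (s ++ t) d = delta_sum s d + delta_sum t d.
Proof. by rewrite /delta_sum big_cat. Qed.

Lemma delta_sum_cons p s d : delta_sum (p :: s) d = delta (sval p.1) (d p.2) + delta_sum s d.
Proof. by rewrite /delta_sum big_cons. Qed.

Lemma delta_sum_map s (d e : 'B(G)) :
  delta_sum [seq (p.1, d p.2) | p <- s] e = delta_sum s (e * d).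
Proof. by rewrite /delta_sum big_map. Qed.

Lemma delta_sum_scale s z d : delta_sum [seq (p.1, z *: p.2) | p <- s] d = z *: delta_sum s d.
Proof. by rewrite /delta_sum big_map scaler_sumr; apply: eq_bigr => p _; rewrite !linearZ. Qed.

(** By the derivation rule a delta(b) = delta(a b) - delta(a) b, the span is
    invariant under amp C, compatibly with the right action. *)
Lemma delta_sum_amp a s : C a ->
  exists t, forall d, C d -> amp a (delta_sum s d) = delta_sum t d.
Proof.
move=> Ca; elim: s => [|[[b Cb] x] s [t IH]].
  by exists [::] => d _; rewrite /delta_sum !big_nil linear0.
exists [:: (exist _ (a * b) (masaM masaC Ca Cb), x), (exist _ a Ca, - b x) & t] => d Cd.
have h : amp a (delta b (d x)) = delta (a * b) (d x) + delta a (d (- b x)).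
  rewrite delta_cocycle !linearN -[b (d x)]blinM (masa_comm masaC Cb Cd) blinM.
  by rewrite addrK.
rewrite !delta_sum_cons linearD -(IH d Cd) addrA; exact: (congr1 (+%R^~ _) h).
Qed.

(** The right action is well defined and bounded. With r k the norm of
    [delta_sum s (c ^+ k)], Cauchy-Schwarz and normality of c show that r is
    log-convex; it grows at most like the powers of a bound of c. This replaces
    the square root of M^2 - adj c * c in the usual argument. *)
Lemma delta_sum_bound c : C c ->
  exists2 M, 0 <= M & forall s, rnorm (delta_sum s c) <= M * rnorm (delta_sum s 1).
Proof.
move=> Cc; have Cc' := masa_adj masaC Cc; have [M M0 cM] := blin_rnorm_bound c.
exists (2 * (M + 1)); first by rewrite mulr_ge0// addr_ge0.
move=> s; suff: rnorm (delta_sum s (c ^+ 1)) <= 2 * (M + 1) * rnorm (delta_sum s (c ^+ 0)).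
  by rewrite expr1 expr0.
have Zadj e : rnorm (delta_sum s (adj c * e)) = rnorm (delta_sum s (c * e)).
  apply/eqP; rewrite -(eqrXn2 (n := 2)) ?rnorm_ge0//; apply/eqP.
  rewrite !rnorm_sq delta_sum_move// [in RHS]delta_sum_move// !mulrA adjK.
  by rewrite (masa_comm masaC Cc Cc').
have [A hA] : exists A, forall k, rnorm (delta_sum s (c ^+ k)) <= A * M ^+ k.
  elim: s {Zadj} => [|[[a Ca] x] s [A hA]].
    by exists 0 => k; rewrite mul0r /delta_sum big_nil rnorm0.
  have [N N0 aN] := blin_rnorm_bound (delta a).
  exists (N * rnorm x + A) => k; rewrite /delta_sum big_cons -/(delta_sum s _).
  rewrite (le_trans (rnormD _ _))// mulrDl lerD//= (le_trans (aN _))//.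
  rewrite -mulrA ler_wpM2l//; elim: k => [|k IH]; first by rewrite mulr1.
  by rewrite exprS blinM (le_trans (cM _))// exprS mulrCA ler_wpM2l.
apply: (log_convex_bound _ M0 _ hA) => k; first exact: rnorm_ge0.
rewrite rnorm_sq [c ^+ k.+1 in X in '[X, _]]exprS delta_sum_move//.
have := Re_ip_le (delta_sum s (c ^+ k)) (delta_sum s (adj c * c ^+ k.+1)).
by rewrite ler_norml => /andP[_]; rewrite Zadj -exprS.
Qed.

Definition delta_span : set K := [set z | exists s, z = delta_sum s 1].

Lemma rho_exists : exists rho : 'B(G) -> 'B(K), forall c, C c ->
  [/\ forall s d, rho c (delta_sum s d) = delta_sum s (c * d),
      forall z, perp delta_span z -> rho c z = 0 &
      forall z, perp (perp delta_span) (rho c z)].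
Proof.
suff /boolp.choice[f fP] : forall c, exists T : 'B(K), C c ->
    [/\ forall s d, T (delta_sum s d) = delta_sum s (c * d),
      forall z, perp delta_span z -> T z = 0 &
      forall z, perp (perp delta_span) (T z)] by exists f.
move=> c; have [Cc|nCc] := pselect (C c); last by exists 0.
have [M M0 cM] := delta_sum_bound Cc.
have [|||T [T1 T2 T3 _]] := @relation_extension _ K K
  (fun p q => exists s, p = delta_sum s 1 /\ q = delta_sum s c) M M0.
- by exists [::]; rewrite /delta_sum !big_nil.
- move=> a p q p' q' [s [-> ->]] [s' [-> ->]].
  exists ([seq (p.1, a *: p.2) | p <- s] ++ s').
  by rewrite !delta_sum_cat !delta_sum_scale.
- by move=> p q [s [-> ->]].
exists T => _; split.
- move=> s d; pose t := [seq (p.1, d p.2) | p <- s].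
  have := T1 (delta_sum t 1) (delta_sum t c).
  by rewrite !delta_sum_map mul1r; apply; exists t; rewrite !delta_sum_map mul1r.
- move=> z Xz; apply: T2; apply: perp_sub Xz => p [q [s [-> _]]].
  by exists s.
- move=> z; apply: perp_sub (T3 z); apply: perp_sub => _ [p [s [_ ->]]].
  by exists [seq (p.1, c p.2) | p <- s]; rewrite delta_sum_map mul1r.
Qed.

Definition rho : 'B(G) -> 'B(K) := sval (cid rho_exists).

Lemma rho_delta_sum c s d : C c -> rho c (delta_sum s d) = delta_sum s (c * d).
Proof. by move=> Cc; have [h _ _] := svalP (cid rho_exists) c Cc; exact: h. Qed.
Lemma rho_perp c z : C c -> perp delta_span z -> rho c z = 0.
Proof. by move=> Cc; have [_ h _] := svalP (cid rho_exists) c Cc; exact: h. Qed.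
Lemma rho_ran c z : C c -> perp (perp delta_span) (rho c z).
Proof. by move=> Cc; have [_ _ h] := svalP (cid rho_exists) c Cc; exact: h. Qed.

Lemma rho_delta c a x : C c -> C a -> rho c (delta a x) = delta a (c x).
Proof.
move=> Cc Ca; have := rho_delta_sum [:: (exist _ a Ca, x)] 1 Cc.
by rewrite mulr1 /delta_sum !big_seq1.
Qed.

(** Both sides vanish on the complement of the span and take values in its
    closure; on the span they are compared by [delta_sum_move]. *)
Lemma adjoint_rho c : C c -> adjoint (rho c) = rho (adj c).
Proof.
move=> Cc; have Cc' := masa_adj masaC Cc.
apply/eqP; rewrite -subr_eq0; apply/eqP; apply: (@blin_eq0_perp _ _ _ _ delta_span).
  move=> _ [s ->]; apply: (@perp_perp0 _ _ delta_span).
    move=> _ [t ->]; rewrite blinB ipBr -adjointE !rho_delta_sum//.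
    by rewrite delta_sum_move// subrr.
  move=> p Xp; rewrite blinB ipBr -adjointE rho_perp// ip0l.
  by rewrite (rho_ran _ Cc' Xp) subrr.
move=> z Xz; rewrite blinB [rho _ z]rho_perp// subr0.
by apply: ip_ext => y; rewrite adjointEl ip0l; exact: (rho_ran y Cc Xz).
Qed.

Lemma rho_adj c z w : C c -> '[rho c z, w] = '[z, rho (adj c) w].
Proof. by move=> Cc; rewrite -adjoint_rho// adjointE. Qed.

Lemma perp_delta_span_amp a z : C a -> perp delta_span z -> perp delta_span (amp a z).
Proof.
move=> Ca Xz _ [s ->]; have Ca' := masa_adj masaC Ca.
rewrite -[a]adjK -amp_adj; have [t ->] := delta_sum_amp s Ca'; last exact: masa1.
by apply: Xz; exists t.
Qed.

Lemma rho_amp a c z : C a -> C c -> rho c (amp a z) = amp a (rho c z).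
Proof.
move=> Ca Cc; suff : rho c * amp a - amp a * rho c = 0.
  by move=> /(congr1 (fun T : 'B(K) => T z)); rewrite blinB => /eqP; rewrite subr_eq0 => /eqP.
have C1 := masa1 masaC.
apply: (@blin_eq0_perp _ _ _ _ delta_span) => [_ [s ->]|w Xw]; rewrite blinB !blinM.
  have [t tE] := delta_sum_amp s Ca.
  by rewrite tE// !rho_delta_sum// mulr1 tE// subrr.
rewrite [rho c w]rho_perp// (rho_perp Cc (perp_delta_span_amp Ca Xw)).
by rewrite linear0 subrr.
Qed.

Lemma rhoC a c z : C a -> C c -> rho c (rho a z) = rho a (rho c z).
Proof.
move=> Ca Cc; suff : rho c * rho a - rho a * rho c = 0.
  by move=> /(congr1 (fun T : 'B(K) => T z)); rewrite blinB => /eqP; rewrite subr_eq0 => /eqP.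
apply: (@blin_eq0_perp _ _ _ _ delta_span) => [_ [s ->]|w Xw]; rewrite blinB !blinM.
  by rewrite !rho_delta_sum// !mulrA (masa_comm masaC Ca Cc) subrr.
by rewrite (rho_perp Ca Xw) (rho_perp Cc Xw) !linear0 addr0.
Qed.

Lemma right_action_exists : exists r : 'B(G) -> 'B(K),
  [/\ forall a c x, C a -> C c -> r c (delta a x) = delta a (c x),
      forall c z w, C c -> '[r c z, w] = '[z, r (adj c) w],
      forall a c z, C a -> C c -> r c (amp a z) = amp a (r c z) &
      forall a c z, C a -> C c -> r c (r a z) = r a (r c z)].
Proof.
exists rho; split.
- by move=> a c x Ca Cc; exact: rho_delta.
- exact: rho_adj.
- by move=> a c z Ca Cc; exact: rho_amp.
- by move=> a c z Ca Cc; exact: rhoC.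
Qed.

End Necessity.

(** * The derivation is inner *)
Section Innerness.
Context {R : realType} {I : choiceType} {G : hilbert R}.
Local Notation K := (l2_hilbert I G).
Variables (C : set 'B(G)) (masaC : masa C) (V : blin G K) (rho : 'B(G) -> 'B(K)).
Hypothesis (rho_delta : forall a c x, C a -> C c -> rho c (delta V a x) = delta V a (c x)).
Hypothesis (rho_adj : forall c z w, C c -> '[rho c z, w] = '[z, rho (adj c) w]).
Hypothesis (rho_amp : forall a c z, C a -> C c -> rho c (amp a z) = amp a (rho c z)).
Hypothesis (rhoC : forall a c z, C a -> C c -> rho c (rho a z) = rho a (rho c z)).

(** The inner derivation of D is c |-> left_minus_right c D. Its matrix entries
    will be the coefficients c_ij(c). *)
Definition left_minus_right c : 'B(K) := amp c - rho c.
Local Notation N := left_minus_right.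
Local Notation delta := (delta V).

Lemma NE c z : N c z = amp c z - rho c z. Proof. by []. Qed.
Lemma N_adj c z w : C c -> '[N c z, w] = '[z, N (adj c) w].
Proof. by move=> Cc; rewrite !NE ipBl ipBr amp_adj rho_adj. Qed.
Lemma N_rho a c z : C a -> C c -> N a (rho c z) = rho c (N a z).
Proof. by move=> Ca Cc; rewrite !NE linearB /= rho_amp// rhoC. Qed.
Lemma N_amp a c z : C a -> C c -> N a (amp c z) = amp c (N a z).
Proof.
move=> Ca Cc; rewrite !NE linearB /= rho_amp//; congr (_ - _).
by rewrite -!ampM (masa_comm masaC Ca Cc).
Qed.

Let UT := {u : 'B(G) | C u /\ unitary u}.

Let Umul (u v : UT) : UT := exist _ (sval u * sval v)
  (conj (masaM masaC (svalP u).1 (svalP v).1) (unitaryM (svalP u).2 (svalP v).2)).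

Let U1 : UT := exist _ 1 (conj (masa1 masaC) unitary1).

Let U_eq (u v : UT) : sval u = sval v -> u = v.
Proof. by case: u v => [u Cu] [v Cv] /= uv; apply: eq_exist. Qed.

Let UmulA : associative Umul.
Proof. by move=> u v w; apply: U_eq; rewrite /= mulrA. Qed.
Let UmulC : commutative Umul.
Proof. by move=> u v; apply: U_eq; apply: (masa_comm masaC (svalP u).1 (svalP v).1). Qed.
Lemma rnorm_amp_unitary u (z : K) : unitary u -> rnorm (amp u z) = rnorm z.
Proof.
move=> [uu _]; apply/eqP; rewrite -(eqrXn2 (n := 2)) ?rnorm_ge0//; apply/eqP.
by rewrite !rnorm_sq amp_adj -ampM uu amp1.
Qed.

(** The orbit of 0 under the affine maps
      z |-> amp (adj u) (rho u z) + amp (adj u) (delta u x),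
    which represent the unitary group of C isometrically on the closed span of
    the derivation. A common fixed point solves the equations for D x. *)
Let orbit x (g : UT) : K := amp (adj (sval g)) (delta (sval g) x).

Lemma orbit_bound (M : R) x g : (forall x, rnorm (V x) <= M * rnorm x) ->
  rnorm (orbit x g) <= 2 * M * rnorm x.
Proof.
move=> VM; rewrite /orbit rnorm_amp_unitary; last exact/unitary_adj/(svalP g).2.
rewrite deltaE (le_trans (rnormD _ _))// rnormN rnorm_amp_unitary; last exact: (svalP g).2.
rewrite -mulrA mulr_natl mulr2n lerD//.
by rewrite (le_trans (VM _))// (unitary_rnorm _ (svalP g).2).
Qed.

(** Translation of the orbit measures how far one of its points is from being a
    fixed point. *)
Lemma orbit_cocycle x g v :
  N (sval v) (orbit x g) - delta (sval v) x = amp (sval v) (orbit x g - orbit x (Umul g v)).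
Proof.
have [Cv [_ vv]] := svalP v; have [Cg [gg _]] := svalP g.
have h : amp (sval v) (orbit x (Umul g v)) = delta (sval v) x + rho (sval v) (orbit x g).
  rewrite /orbit -[sval (Umul g v)]/(sval g * sval v) delta_cocycle -ampM adjM.
  rewrite mulrA vv mul1r blin_add.
  by rewrite -ampM gg amp1 rho_amp ?rho_delta//; exact: masa_adj.
rewrite blin_sub h NE; move: (amp _ _) (rho _ _) (delta _ _) => a b d.
by rewrite opprD addrA [RHS]addrAC.
Qed.

(** The adjoint of D has to map p to q for all pairs in this relation, since
    <D x, (amp (adj u) - rho (adj u)) z> = <delta u x, z>. *)
Let rel (p : K) (q : G) := exists t : seq (UT * K),
  p = \sum_(w <- t) N (adj (sval w.1)) w.2 /\
  q = \sum_(w <- t) adjoint (delta (sval w.1)) w.2.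

(** Pairing q with x gives a sum of terms <delta u x, z>. An average of the orbit
    of norm at most 2 M |x| is an approximate solution D x for all the finitely
    many u that occur, so that <x, q> is almost the pairing of this average
    with p. This is used for x = q. *)
Lemma rel_bound (M : R) p q : 0 <= M -> (forall x, rnorm (V x) <= M * rnorm x) -> rel p q ->
  rnorm q <= 2 * M * rnorm p.
Proof.
move=> M0 VM [t [pE qE]].
suff h : rnorm q ^+ 2 <= 2 * M * rnorm q * rnorm p.
  have := rnorm_ge0 q; rewrite le_eqVlt => /predU1P[<-|q0].
    by rewrite !mulr_ge0// rnorm_ge0.
  by rewrite -(ler_pM2l q0) -expr2 (le_trans h)// mulrCA !mulrA.
rewrite -subr_le0; apply: le0_all_eps => e e0.
(* An error of e' for each u is multiplied by the norms of the vectors z. *)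
set Y := \sum_(w <- t) rnorm w.2.
have Y0 : 0 < Y + 1 by rewrite ltr_wpDl// /Y sumr_ge0// => w _; exact: rnorm_ge0.
have [e' e'E e1] : exists2 e', e' * (Y + 1) = e & 0 < e'.
  by exists (e / (Y + 1)); rewrite ?divfK ?divr_gt0// gt_eqF.
have B0 : 0 <= 2 * M * rnorm q by rewrite !mulr_ge0// rnorm_ge0.
have [gs [gs0 gsP]] := @folner _ K _ _ U1 UmulA UmulC [seq w.1 | w <- t] _ _ B0 e1.
have {}gsP := gsP (orbit q) (fun g => orbit_bound q g VM).
set n : R := (size gs)%:R in gsP.
have n0 : 0 < n by rewrite ltr0n.
set S := \sum_(g <- gs) orbit q g.
have SB : rnorm S <= n * (2 * M * rnorm q).
  rewrite (le_trans (ler_rnorm_sum _ _))// (le_trans (ler_sum _ (fun g _ => orbit_bound q g VM)))//.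
  by rewrite big_const_seq count_predT iter_addr_0 -[leLHS]mulr_natl.
have key : `|n * Re '[q, q] - Re '[S, p]| <= e' * n * Y.
  rewrite pE; have -> : '[q, q] = '[q, \sum_(w <- t) adjoint (delta (sval w.1)) w.2].
    by rewrite -qE.
  rewrite !ip_sumr; rewrite /Y; elim: t gsP {pE qE Y0 e'E} @Y => [|[v z] t IH].
    by rewrite !big_nil !mulr0 subrr normr0.
  rewrite map_cons !big_cons => -[gv /IH{}IH].
  have Sv : N (sval v) S - n%:C *: delta (sval v) q =
      amp (sval v) (- \sum_(g <- gs) (orbit q (Umul g v) - orbit q g)).
    rewrite -sumrN /S !blin_sum.
    under [RHS]eq_bigr do rewrite opprB -orbit_cocycle.
    rewrite [RHS]sumrB; congr (_ - _).
    by rewrite big_const_seq count_predT iter_addr_0 /n rmorph_nat scaler_nat.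
  have zv : `|n * Re '[q, adjoint (delta (sval v)) z] - Re '[S, N (adj (sval v)) z]|
      <= e' * n * rnorm z.
    have Cv := (svalP v).1.
    rewrite -adjointE -(N_adj S z Cv).
    rewrite -Re_scale distrC -Re_sub -ipZl -ipBl Sv.
    rewrite (le_trans (Re_ip_le _ _))// ler_wpM2r ?rnorm_ge0//.
    by rewrite rnorm_amp_unitary ?rnormN//; exact: (svalP v).2.
  rewrite /= !Re_add mulrDr opprD addrACA mulrDr.
  by rewrite (le_trans (ler_normD _ _))// lerD.
have key2 : `|Re '[S, p]| <= n * (2 * M * rnorm q) * rnorm p.
  by rewrite (le_trans (Re_ip_le _ _))// ler_wpM2r// rnorm_ge0.
rewrite -(ler_pM2l n0) rnorm_sq.
have h1 : e' * n * Y <= n * e.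
  by rewrite [_ * n]mulrC -mulrA ler_pM2l// -e'E ler_pM2l// lerDl.
move: key key2; rewrite !ler_norml => /andP[_ k1] /andP[_ k2].
rewrite mulrBr (le_trans _ h1)//; lra.
Qed.

(** The intertwining relation D c = rho c D comes from the uniqueness part: both
    adj c o E and E o rho (adj c), for E the adjoint of D, agree on the domain
    of the relation and vanish on its complement. *)
Lemma implementer_exists : exists D : blin G K,
  (forall u x, C u -> unitary u -> N u (D x) = delta u x) /\
  (forall c x, C c -> D (c x) = rho c (D x)).
Proof.
have [M M0 VM] := blin_rnorm_bound V.
have relu u z : C u -> unitary u -> rel (N (adj u) z) (adjoint (delta u) z).
  by move=> Cu uu; exists [:: (exist _ u (conj Cu uu), z)]; rewrite !big_seq1.
have [||||E [E1 E2 _ _]] := @relation_extension _ K G rel (2 * M).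
- by rewrite mulr_ge0.
- by exists [::]; rewrite !big_nil.
- move=> a p q p' q' [t [-> ->]] [t' [-> ->]].
  exists ([seq (w.1, a *: w.2) | w <- t] ++ t'); rewrite !big_cat !big_map.
  rewrite !scaler_sumr; split; congr (_ + _); apply: eq_bigr => w _.
    exact/esym/(blin_scale (N (adj (sval w.1)))).
  exact/esym/(blin_scale (adjoint (delta (sval w.1)))).
- by move=> p q; exact: rel_bound.
exists (adjoint E); split.
  move=> u x Cu uu; apply: ip_ext => z.
  rewrite N_adj// adjointEl (E1 _ _ (relu u z Cu uu)).
  by rewrite -adjointE.
move=> c x Cc; have Cc' := masa_adj masaC Cc; apply: ip_ext => z.
rewrite rho_adj// !adjointEl adjE; congr ('[_, _]); move: z.
suff : bcomp (adj c) E - bcomp E (rho (adj c)) = 0.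
  move=> h z; apply/eqP; rewrite -subr_eq0 -!bcompE -blinB h; exact/eqP.
apply: (@blin_eq0_perp _ _ _ _ [set p | exists q, rel p q]).
  move=> _ [_ [t [-> _]]]; rewrite blin_sum; apply: big1 => w _.
  have [Cu uu] := svalP w.1; move: (sval w.1) (w.2) Cu uu => u z Cu uu.
  rewrite blinB !bcompE -N_rho//; last exact: masa_adj.
  rewrite !(E1 _ _ (relu u _ Cu uu)); apply/eqP; rewrite subr_eq0; apply/eqP.
  apply: ip_ext => y; rewrite adjEl !adjointEl.
  by rewrite -(rho_delta _ Cu Cc) rho_adj// adjK.
move=> w pw; rewrite blinB !bcompE (E2 w)// linear0 E2 ?subrr//.
move=> _ [_ [t [-> _]]]; rewrite ip_suml; apply: big1 => s _.
have [Cu uu] := svalP s.1; move: (sval s.1) (s.2) Cu uu => u z Cu uu.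
rewrite -rho_adj// -N_rho//; last exact: masa_adj.
by apply: pw; exists (adjoint (delta u) (rho c z)); exact: relu.
Qed.

End Innerness.

(** * Decomposition of the generator *)
Section Decomposition.
Context {R : realType} {I : choiceType} {G : hilbert R}.
Local Notation K := (l2_hilbert I G).
Variables (C : set 'B(G)) (masaC : masa C).

(** A derivation of C into C vanishes. For a unitary u with e = [u, k] in C,
    the Leibniz rule gives [u^n, k] = n u^(n - 1) e, whose norm is n |e| and yet
    bounded by 2 |k|. *)
Lemma commutator_masa_eq0 (k : 'B(G)) :
  (forall c, C c -> C (c * k - k * c)) -> C k.
Proof.
move=> kC; apply: (masa_unitary_commutant masaC) => u Cu uu.
set e := u * k - k * u; have Ce : C e := kC u Cu.
suff e0 : e = 0 by apply/esym/eqP; rewrite -subr_eq0; exact/eqP.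
have ue n : C (u ^+ n).
  elim: n => [|n IH]; first exact: masa1.
  by rewrite exprS; exact: masaM.
have hnu n x : rnorm ((u ^+ n) x) = rnorm x.
  by elim: n => [|n IH]//; rewrite exprS blinM unitary_rnorm.
have Leibniz n : u ^+ n.+1 * k - k * u ^+ n.+1 = u ^+ n * e *+ n.+1.
  elim: n => [|n IH]; first by rewrite expr1 expr0 mul1r.
  have h w : u * w * k - k * (u * w) = u * (w * k - k * w) + e * w.
    by rewrite mulrBr /e mulrBl !mulrA addrA subrK.
  by rewrite [u ^+ n.+2]exprS h IH (masa_comm masaC Ce (ue _)) mulrnAr mulrA -exprS -mulrSr.
have [M M0 kM] := blin_rnorm_bound k.
apply: blin_ext => x; apply/eqP; rewrite blin0 -normr_le0 -rnormE lecR.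
have bound n : n.+1%:R * rnorm (e x) <= 2 * M * rnorm x.
  have -> : n.+1%:R * rnorm (e x) = rnorm ((u ^+ n.+1 * k - k * u ^+ n.+1) x).
    rewrite Leibniz -[_ * e *+ _]scaler_nat blinZ rnormZ blinM hnu normr_nat.
    by rewrite -(rmorph_nat (real_complex R)).
  rewrite blinB !blinM (le_trans (rnormD _ _))// rnormN hnu -mulrA mulr_natl mulr2n.
  by rewrite lerD// (le_trans (kM _))// hnu.
rewrite leNgt; apply/negP => ex0.
have [n nP] : exists n : nat, 2 * M * rnorm x / rnorm (e x) < n%:R.
  exists (Num.bound (2 * M * rnorm x / rnorm (e x))); rewrite archi_boundP//.
  by rewrite divr_ge0 ?rnorm_ge0// !mulr_ge0// rnorm_ge0.
have := bound n; rewrite -ler_pdivlMr// leNgt => /negP; apply.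
by rewrite (lt_trans nP)// ltr_nat.
Qed.

Variables (V : blin G K) (L : 'B(G) -> 'B(G)) (beta : 'B(G)).
Hypothesis (LE : forall b x y,
  '[amp b (V x), V y] = '[L b x, y] - '[beta x, adj b y] - '[b x, beta y]).
Hypothesis (LC : forall c, C c -> C (L c)).

(** D is the part of V that carries the derivation, N c the difference of the
    left and the right action of c. *)
Lemma decomposition_exists : exists (D : blin G K) (N : 'B(G) -> 'B(K)) (gamma : 'B(G)),
  [/\ forall i, C (bcomp (l2_coord i) (V - D)),
      forall c, C c -> [/\ forall x, N c (D x) = amp c (V x) - V (c x),
        forall z w, '[N c z, w] = '[z, N (adj c) w] &
        forall a z, C a -> N c (amp a z) = amp a (N c z)],
      C gamma /\ adj gamma = gamma &
      forall c x y, C c -> '[amp c (D x), D y] = '[(L c - gamma * c) x, y]].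
Proof.
have [r [rd radj ramp rC]] := right_action_exists masaC LE LC.
have [D [D1 D2]] := implementer_exists masaC rd radj ramp rC.
set eta := V - D.
have Ceta i : C (bcomp (l2_coord i) eta).
  apply: (masa_unitary_commutant masaC) => u Cu uu; apply: blin_ext => x.
  rewrite !blinM !bcompE -coord_amp; congr (l2_coord i _).
  have := D1 u x Cu uu; rewrite NE deltaE -D2// => h.
  rewrite /eta !blinB blin_sub; move: h.
  move: (amp u (D x)) (D (u x)) (amp u (V x)) (V (u x)) => a b a' b' h.
  have -> : b' - b = (a - b) + (b' - a) by rewrite [RHS]addrC addrA subrK.
  by rewrite h addrA subrK.
have etac c x : C c -> amp c (eta x) = eta (c x).
  move=> Cc; apply: l2_coord_ext => i; rewrite coord_amp -[l2_coord i (eta x)]bcompE.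
  by rewrite -blinM (masa_comm masaC Cc (Ceta i)) blinM bcompE.
pose P c : 'B(G) := bcomp (adjoint D) (bcomp (amp c) D).
have PE c x y : '[P c x, y] = '[amp c (D x), D y] by rewrite !bcompE adjointEl.
have CP c : C c -> C (P c).
  move=> Cc; apply: (masa_commutant masaC) => d Cd; apply: blin_ext => x.
  apply: ip_ext => y; rewrite !blinM PE [RHS]adjE PE D2// -ramp// radj// -D2//.
  exact: masa_adj.
pose Psi c := L c - P c.
have CPsi c : C c -> C (Psi c).
  by move=> Cc; apply: masaB => //; [exact: LC|exact: CP].
(* Expanding V = D + eta in the Lindblad form, with eta commuting past C, each
   mixed term goes to one side of c; the term in eta alone may go to either
   side and is split evenly. *)
pose k : 'B(G) := beta + bcomp (adjoint eta) D + (2^-1 : R[i]) *: bcomp (adjoint eta) eta.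
have PsiE c : C c -> Psi c = c * k + adj k * c.
  move=> Cc; apply: blin_ext => x; apply: ip_ext => y.
  have VE z : V z = D z + eta z by rewrite blinB addrC subrK.
  have e1 : '[amp c (D x), eta y] = '[bcomp (adjoint eta) D x, adj c y].
    by rewrite amp_adj etac ?bcompE ?adjointEl//; exact: masa_adj.
  have e2 : '[amp c (eta x), D y] = '[c x, bcomp (adjoint eta) D y].
    by rewrite etac// bcompE -adjointE.
  have e3 : '[amp c (eta x), eta y] = '[c x, bcomp (adjoint eta) eta y].
    by rewrite etac// bcompE -adjointE.
  have e4 : '[amp c (eta x), eta y] = '[bcomp (adjoint eta) eta x, adj c y].
    by rewrite amp_adj etac ?bcompE ?adjointEl//; exact: masa_adj.
  have := LE c x y; rewrite !VE blin_add ipDl !(ipDr _ (D y) (eta y)).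
  rewrite e1 e2 => LEc.
  have -> : '[Psi c x, y] = '[L c x, y] - '[amp c (D x), D y].
    by rewrite /Psi blinB ipBl PE.
  have -> : '[(c * k + adj k * c) x, y] = '[k x, adj c y] + '[c x, k y].
    by rewrite blinD ipDl !blinM adjEl adjE.
  have -> : '[k x, adj c y] = '[beta x, adj c y] + '[bcomp (adjoint eta) D x, adj c y] +
      2^-1 * '[amp c (eta x), eta y].
    by rewrite e4 /k !blinD blinZ !ipDl ipZl.
  have -> : '[c x, k y] = '[c x, beta y] + '[c x, bcomp (adjoint eta) D y] +
      2^-1 * '[amp c (eta x), eta y].
    rewrite e3 /k !blinD blinZ !ipDr ipZr; congr (_ + _ * _).
    by rewrite conj_Creal// rpredV realn.
  have <- : '[amp c (D x), D y] + '[bcomp (adjoint eta) D x, adj c y] +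
   ('[c x, bcomp (adjoint eta) D y] + '[amp c (eta x), eta y]) +
     '[beta x, adj c y] + '[c x, beta y] = '[L c x, y] by rewrite LEc; ring.
  have h2 : (2^-1 + 2^-1 : R[i]) = 1 by rewrite -mulr2n -(mulr_natr 2^-1 2) mulVf// pnatr_eq0.
  move: ('[amp c (eta x), eta y]) => E.
  have E2 : E = 2^-1 * E + 2^-1 * E by rewrite -mulrDl h2 mul1r.
  by rewrite {1}E2; ring.
pose gamma := Psi 1.
have C1 := masa1 masaC.
have gE : gamma = k + adj k by rewrite /gamma PsiE// mul1r mulr1.
have dk c : C c -> Psi c - gamma * c = c * k - k * c.
  by move=> Cc; rewrite PsiE// gE mulrDl opprD addrACA subrr addr0.
have Ck : C k.
  apply: commutator_masa_eq0 => c Cc; rewrite -dk//.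
  by apply: masaB => //; [exact: CPsi|apply: masaM => //; exact: CPsi].
exists D, (left_minus_right r), gamma; split=> //.
- move=> c Cc; split.
  + move=> x; rewrite NE -D2//.
    have := etac c x Cc; rewrite /eta !blinB blin_sub => h.
    move: h; move: (amp c (D x)) (D (c x)) (amp c (V x)) (V (c x)) => a b a' b' h.
    have -> : a' - b' = a - b + ((a' - a) - (b' - b)).
      by rewrite opprB addrACA [a + _]addrC subrK addKr.
    by rewrite h subrr addr0.
  + by move=> z w; apply: (N_adj radj).
  + by move=> a z Ca; apply: (N_amp masaC ramp).
- by split; [exact: CPsi|rewrite gE adjD adjK addrC].
- move=> c x y Cc; have := dk c Cc; rewrite (masa_comm masaC Cc Ck) subrr.
  move/eqP; rewrite subr_eq0 => /eqP <-; rewrite -PE; congr ('[_, _]).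
  by rewrite /Psi blinB subKr.
Qed.

End Decomposition.

(** * Invariance from the coefficients *)
Section Sufficiency.
Context {R : realType} {I : choiceType} {G : hilbert R}.
Local Notation K := (l2_hilbert I G).
Variables (C : set 'B(G)) (masaC : masa C) (D : blin G K) (d : I -> 'B(G)).
Hypothesis DE : forall i x, l2_coord i (D x) = d i x.
Variables (cf : 'B(G) -> I -> I -> 'B(G)) (s : 'B(G) -> I -> 'B(G)).
Hypothesis cfC : forall c i j, C c -> C (cf c i j).
Hypothesis cf_adj : forall c i j, C c -> cf (adj c) i j = adj (cf c j i).
Hypothesis sE : forall c i x, C c -> s c i x = c (d i x) - d i (c x).
Hypothesis cf_sum : forall c, C c ->
  strong_column_sum (fun i j => cf c i j * d j) (s c).

Let S c x : K := amp c (D x) - D (c x).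

Let coord_S c i x : C c -> l2_coord i (S c x) = s c i x.
Proof. by move=> Cc; rewrite blin_sub coord_amp !DE sE. Qed.

Lemma has_sum_sum (J : {fset I}) (F : I -> I -> R[i]) (l : I -> R[i]) :
  (forall j, has_sum (F j) (l j)) ->
  has_sum (fun i => \sum_(j <- J) F j i) (\sum_(j <- J) l j).
Proof.
move=> Fl; elim: (enum_fset J) => [|j r IH].
  by rewrite big_nil; apply: has_sum_ext (has_sum0) => i; rewrite big_nil.
rewrite big_cons; apply: has_sum_ext (has_sumD (Fl j) IH) => i.
by rewrite big_cons.
Qed.

(** The second part of [strong_column_sum]: the truncated sums over j differ from
    the column S c x by a vector of K of small norm. *)
Lemma column_truncation c x (e : R) : C c -> 0 < e -> exists J0, forall J, (J0 `<=` J)%fset ->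
  exists z : K, (forall i, l2_coord i z = \sum_(j <- J) cf c i j (d j x)) /\ rnorm (S c x - z) <= e.
Proof.
move=> Cc e0; have [_ h] := cf_sum Cc.
have [|J0 _ hJ] := h x (e ^+ 2)%:C; first by rewrite ltcR exprn_gt0.
exists J0 => J /hJ /= {}hJ.
have hJ' (J' : {fset I}) :
    \sum_(i <- J') rnorm (s c i x - \sum_(j <- J) cf c i j (d j x)) ^+ 2 <= e ^+ 2.
  rewrite -lecR (le_trans _ (hJ J'))// rmorph_sum le_eqVlt; apply/orP; left; apply/eqP.
  apply: eq_bigr => i _; rewrite -(partial_sumE (fun j => cf c i j * d j)) -blinB.
  by rewrite -rnormE rmorphXn.
have [w wE] := l2_with_coords hJ'.
exists (S c x - w); split.
  by move=> i; rewrite blin_sub wE coord_S// subKr.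
rewrite subKr -(ler_pXn2r (n := 2))// ?nnegrE ?rnorm_ge0 ?(ltW e0)//.
by apply: rnorm_sq_le => J'; under eq_bigr do rewrite wE.
Qed.

(** For the truncations of S c' x to j in J, the sum over i can be carried out
    first, since the rows of c_ij(adj c') converge; the result is a partial sum
    over j of the right hand side. Both sides converge along J, the left one
    by convergence of the columns in K. *)
Lemma defect_move c c' x y : C c -> C c' ->
  '[amp c (S c' x), D y] = '[amp c (D x), S (adj c') y].
Proof.
move=> Cc Cc'; have Cc'' := masa_adj masaC Cc'.
apply/eqP; rewrite -subr_eq0; apply/eqP/Re_norm_eq0/le0_all_eps => e e0.
have [M M0 cM] := blin_rnorm_bound (amp c : 'B(K)).
have e2 : 0 < e / 2 by rewrite divr_gt0.
have B0 : 0 < M * rnorm (D y) + 1 by rewrite ltr_wpDl// mulr_ge0// rnorm_ge0.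
have [J0 h0] := column_truncation x Cc' (divr_gt0 e2 B0).
have [J1 h1] := ip_has_sum (amp c (D x)) (S (adj c') y) e2.
have [z [zE hz]] := h0 (J0 `|` J1)%fset (fsubsetUl _ _).
have {h1} := h1 (J0 `|` J1)%fset (fsubsetUr _ _).
set J := (J0 `|` J1)%fset in zE *.
have -> : \sum_(i <- J) '[l2_coord i (amp c (D x)), l2_coord i (S (adj c') y)] = '[amp c z, D y].
  apply: has_sum_unique (ip_has_sum _ _).
  apply: (@has_sum_ext _ _ (fun i =>
      \sum_(j <- J) '[l2_coord j (amp c (D x)), (cf (adj c') j i * d i) y])).
    move=> i; rewrite coord_amp zE blin_sum ip_suml; apply: eq_bigr => j _.
    rewrite coord_amp !DE blinM cf_adj// -adjE -!blinM.
    by rewrite (masa_comm masaC Cc (cfC i j Cc')).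
  apply: has_sum_sum => j; rewrite coord_S//.
  have [h _] := cf_sum Cc''.
  rewrite ipC; have := strong_sum_ip y (l2_coord j (amp c (D x))) (h j).
  move=> /has_sum_conj; apply: has_sum_ext => i.
  by rewrite -ipC.
move=> h1; rewrite -(subrK '[amp c z, D y] '[amp c (S c' x), D y]).
rewrite -addrA (le_trans (Re_normD _ _))// (splitr e) lerD//; last first.
  by rewrite distrC.
rewrite -ipBl -blin_sub -lecR normC_Re (le_trans (ip_le _ _))// -!rnormE -rmorphM lecR.
rewrite (le_trans (ler_wpM2r (rnorm_ge0 _) (cM _)))//.
rewrite mulrAC (le_trans (ler_wpM2l _ hz))// ?mulr_ge0 ?rnorm_ge0//.
by rewrite mulrCA ger_pMr// ler_pdivrMr// mul1r lerDl.
Qed.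

Variables (L : 'B(G) -> 'B(G)) (gamma : 'B(G)).
Hypothesis Cgamma : C gamma.
Hypothesis LE : forall c x y, C c ->
  '[amp c (D x), D y] = '[(L c - gamma * c) x, y].

Lemma coefficients_invariance c : C c -> C (L c).
Proof.
move=> Cc; rewrite -(subrK (gamma * c) (L c)); apply: masaD => //; last exact: masaM.
apply: (masa_commutant masaC) => c' Cc'; have Cc'' := masa_adj masaC Cc'.
apply: blin_ext => x; apply: ip_ext => y.
rewrite blinM -LE// blinM [RHS]adjE -LE//.
have -> : D (c' x) = amp c' (D x) - S c' x by rewrite /S subKr.
have -> : D (adj c' y) = amp (adj c') (D y) - S (adj c') y by rewrite /S subKr.
rewrite blin_sub ipBl ipBr defect_move// -ampM (masa_comm masaC Cc Cc') ampM.
by rewrite amp_adj.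
Qed.

End Sufficiency.

(** * The semigroup and its generator *)
Section OperatorNorm.
Context {R : realType}.

Lemma rnorm_blin {V W : normedModType R[i]} (f : blin V W) x : rnorm (f x) <= rnorm f * rnorm x.
Proof. by rewrite -lecR rmorphM /= !rnormE; exact: le_opnorm. Qed.

Lemma rnorm_blin_le {V W : normedModType R[i]} (f : blin V W) (M : R) : 0 <= M ->
  (forall x, rnorm (f x) <= M * rnorm x) -> rnorm f <= M.
Proof.
move=> M0 fM; rewrite -lecR rnormE; apply: opnorm_le => [|x]; first by rewrite ler0c.
by rewrite -!rnormE -rmorphM lecR.
Qed.

Lemma rnorm_expr {V : normedModType R[i]} (f : blin V V) k : rnorm (f ^+ k) <= rnorm f ^+ k.
Proof.
elim: k => [|k IH]; first by apply: rnorm_blin_le => // x; rewrite mul1r.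
rewrite !exprS; apply: rnorm_blin_le => [|x]; first by rewrite mulr_ge0 ?exprn_ge0 ?rnorm_ge0.
rewrite (le_trans (rnorm_blin f _))// -mulrA ler_wpM2l ?rnorm_ge0//.
by rewrite (le_trans (rnorm_blin _ _))// ler_wpM2r ?rnorm_ge0.
Qed.

(** For t |f| at most 1/2 the k-th term of the exponential series is at most
    (t |f|)^2 2^(2 - k), so that the remainder is dominated by a geometric
    series. *)
Lemma exp_second_order {V : normedModType R[i]} (f : blin V V) (t : R) n :
  0 <= t -> t * rnorm f <= 2^-1 ->
  rnorm (series (fun k => (t ^+ k / k`!%:R)%:C *: f ^+ k) n.+2 - (1 + t%:C *: f))
    <= 2 * (t * rnorm f) ^+ 2 * (1 - 2^-1 ^+ n).
Proof.
move=> t0; set s := t * rnorm f => s2.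
have s0 : 0 <= s by rewrite mulr_ge0// rnorm_ge0.
elim: n => [|n IH].
  rewrite seriesEnat /= !big_nat_recl// big_geq// addr0 !expr0 !expr1.
  by rewrite fact0 -[(1`!)%N]/1%N !divr1 scale1r subrr rnorm0 subrr mulr0.
rewrite seriesEnat /= big_nat_recr//= -/(series _ n.+2).
rewrite addrAC (le_trans (rnormD _ _))//.
have h : rnorm ((t ^+ n.+2 / (n.+2)`!%:R)%:C *: f ^+ n.+2) <= s ^+ n.+2.
  rewrite rnormZ ger0_norm; last by rewrite ler0c divr_ge0 ?exprn_ge0.
  rewrite Re_real exprMn; apply: ler_pM; rewrite ?divr_ge0 ?exprn_ge0 ?rnorm_ge0 ?rnorm_expr//.
  by rewrite ler_pdivrMr ?ltr0n ?fact_gt0// ler_peMr ?exprn_ge0// ler1n fact_gt0.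
have h2 : s ^+ n.+2 <= s ^+ 2 * 2^-1 ^+ n.
  rewrite -addn2 exprD mulrC ler_wpM2l ?exprn_ge0// lerXn2r// nnegrE.
  by rewrite invr_ge0.
rewrite (le_trans (lerD IH (le_trans h h2)))// [2^-1 ^+ n.+1]exprS.
move: (2^-1 ^+ n) (s ^+ 2) => a b.
by rewrite (_ : 2 * b * (1 - 2^-1 * a) = 2 * b * (1 - a) + b * a)//; field.
Qed.

End OperatorNorm.

Section SemigroupInvariance.
Context {R : realType} {G : hilbert R}.
Variables (C : set 'B(G)) (masaC : masa C).

(** C is its own commutant, and commutation is a closed condition. *)
Lemma masa_closed a : (forall e : R, 0 < e -> exists2 b, C b & rnorm (a - b) <= e) -> C a.
Proof.
move=> aC; apply: (masa_commutant masaC) => c Cc; apply: blin_ext => x.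
apply/eqP; rewrite -subr_eq0 -normr_le0 -rnormE lecR; apply: le0_all_eps => e e0.
have [M M0 cM] := blin_rnorm_bound c.
have B0 : 0 < rnorm (c x) + M * rnorm x + 1.
  by rewrite ltr_wpDl// addr_ge0 ?rnorm_ge0// mulr_ge0// rnorm_ge0.
have [b Cb ab] := aC _ (divr_gt0 e0 B0).
have -> : (a * c) x - (c * a) x = (a - b) (c x) - c ((a - b) x).
  rewrite blinB [(a - b) x]blinB blin_sub -!blinM (masa_comm masaC Cb Cc).
  by rewrite opprB addrA subrK.
rewrite (le_trans (rnormD _ _))// rnormN.
set f := e / _ in ab; have f0 : 0 < f by rewrite divr_gt0.
have fe : f * (rnorm (c x) + M * rnorm x + 1) = e by rewrite divfK// gt_eqF.
have h1 : rnorm ((a - b) (c x)) <= f * rnorm (c x).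
  by rewrite (le_trans (rnorm_blin _ _))// ler_wpM2r ?rnorm_ge0.
have h2 : rnorm (c ((a - b) x)) <= M * (f * rnorm x).
  rewrite (le_trans (cM _))// ler_wpM2l// (le_trans (rnorm_blin _ _))//.
  by rewrite ler_wpM2r ?rnorm_ge0.
rewrite (le_trans (lerD h1 h2))// -fe; lra.
Qed.

Variables (T : R -> blin 'B(G) 'B(G)) (L : blin 'B(G) 'B(G)).
Hypothesis TL : generator T L.

Let S t := series (fun k => (t ^+ k / k`!%:R)%:C *: L ^+ k).

Lemma generator_approx t (e : R) : 0 <= t -> 0 < e -> exists n, rnorm (T t - S t n.+2) <= e.
Proof.
move=> t0 e0; have /cvgrPdist_le/(_ e%:C) := TL t0.
rewrite ltcR => /(_ e0)[n _ h]; exists n; rewrite -lecR rnormE; apply: h => /=.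
by rewrite -addn2 leq_addr.
Qed.

Lemma semigroup_invariance :
  leaves_invariant L C <-> forall t, 0 <= t -> leaves_invariant (T t) C.
Proof.
split=> [LC t t0 c Cc|TC c Cc].
  apply: masa_closed => e e0; have c0 : 0 < rnorm c + 1 by rewrite ltr_wpDl// rnorm_ge0.
  have [n nP] := generator_approx t0 (divr_gt0 e0 c0).
  exists (S t n.+2 c).
    rewrite /S seriesEnat /=; elim: n.+2 => [|m IH].
      by rewrite big_geq//; exact: masa0.
    rewrite big_nat_recr//; apply: (masaD masaC IH); apply: (masaZ masaC).
    elim: m {IH} => [|m IH]//; rewrite exprS; exact: LC.
  rewrite -blinB (le_trans (rnorm_blin _ _))// (le_trans (ler_wpM2r (rnorm_ge0 _) nP))//.
  by rewrite -mulrA ger_pMr// ler_pdivrMl// mulr1 lerDl.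
apply: masa_closed => e e0; set l := rnorm L; have l0 : 0 <= l by exact: rnorm_ge0.
(* The inverse of the time t: large enough for t l to be at most 1/2, and for
   the second order term 2 t l^2 |c| of the difference quotient to be at most
   e. *)
pose q := 2 * (l + 1) + 2 * l ^+ 2 * rnorm c / e.
have q1 : 0 <= 2 * l ^+ 2 * rnorm c / e.
  by rewrite divr_ge0 ?(ltW e0)// !mulr_ge0 ?rnorm_ge0// sqr_ge0.
have q0 : 0 < q by rewrite ltr_wpDr// mulr_gt0// ltr_wpDl.
pose t := q^-1; have t0 : 0 < t by rewrite invr_gt0.
have tl : t * l <= 2^-1.
  by rewrite mulrC ler_pdivrMr// /q; lra.
have bound : rnorm (T t - (1 + t%:C *: L)) <= 2 * (t * l) ^+ 2.
  rewrite -subr_le0; apply: le0_all_eps => d d0.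
  have [n nP] := generator_approx (ltW t0) d0.
  rewrite lerBlDr -[T t](subrK (S t n.+2)) -addrA (le_trans (rnormD _ _))// lerD//.
  rewrite (le_trans (exp_second_order n (ltW t0) tl))//.
  have p1 : 0 <= (2^-1 : R) ^+ n by rewrite exprn_ge0// invr_ge0.
  have p2 := sqr_ge0 (t * l); rewrite -/l; nra.
exists (t^-1%:C *: (T t c - c)).
  by apply: (masaZ masaC); apply: (masaB masaC _ Cc); exact: TC (ltW t0) _ Cc.
have -> : L c - t^-1%:C *: (T t c - c) = - (t^-1%:C *: (T t - (1 + t%:C *: L)) c).
  have t1 : t^-1%:C * t%:C = 1 :> R[i] by rewrite -rmorphM mulVf// gt_eqF.
  have -> : (T t - (1 + t%:C *: L)) c = T t c - (c + t%:C *: L c) by [].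
  move: (T t c) (L c) => a b.
  by rewrite opprD addrA [_ *: (_ - _ - _)]scalerBr scalerA t1 scale1r opprB.
rewrite rnormN rnormZ ger0_norm; last by rewrite ler0c invr_ge0 ltW.
rewrite Re_real.
apply: le_trans (ler_wpM2l _ (rnorm_blin _ _)) _; first by rewrite invr_ge0 ltW.
have h1 : t^-1 * (rnorm (T t - (1 + t%:C *: L)) * rnorm c) <= t^-1 * (2 * (t * l) ^+ 2 * rnorm c).
  apply: ler_wpM2l; first by rewrite invr_ge0 ltW.
  by apply: ler_wpM2r => //; exact: rnorm_ge0.
apply: le_trans h1 _; rewrite (_ : _ * _ = t * (2 * l ^+ 2 * rnorm c)).
  rewrite mulrC ler_pdivrMr// /q mulrDr; rewrite [X in _ + X]mulrCA divff ?gt_eqF// mulr1.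
  by rewrite lerDr !mulr_ge0 ?(ltW e0)// addr_ge0.
rewrite exprMn expr2; field; exact: lt0r_neq0.
Qed.

End SemigroupInvariance.

(** * Strong sums as columns and matrix entries *)
Section ColumnSums.
Context {R : realType} {I : choiceType} {G : hilbert R}.
Local Notation K := (l2_hilbert I G).

Lemma nneg_sum_le (a : I -> R) (s : R[i]) (J : {fset I}) : (forall i, 0 <= a i) ->
  has_sum (fun i => (a i)%:C) s -> \sum_(i <- J) a i <= Re s.
Proof.
move=> a0 aS; rewrite -subr_le0; apply: le0_all_eps => e /aS[J0 h].
have := h (J0 `|` J)%fset (fsubsetUl _ _).
have := ler_sum_fset a0 (fsubsetUr J0 J).
rewrite -rmorph_sum; set t := \sum_(i <- J) a i; set t' := \sum_(i <- _) a i => h1 h2.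
have : Re (t'%:C - s) <= e by rewrite (le_trans (ler_norm _))// Re_le// distrC -normC_Re lecR.
rewrite Re_sub Re_real; lra.
Qed.

(** The partial sums of |d_i x|^2 increase to <S x, x>. *)
Lemma strong_column_exists (d : I -> 'B(G)) S :
  strong_sum (fun i => adj (d i) * 1 * d i) S ->
  exists D : blin G K, forall i x, l2_coord i (D x) = d i x.
Proof.
move=> dS; have [M M0 SM] := blin_rnorm_bound S.
apply: (@column_exists _ _ _ _ M) => J x.
have h : has_sum (fun i => (rnorm (d i x) ^+ 2)%:C) '[S x, x].
  by apply: has_sum_ext (strong_sum_ip x x dS) => i; rewrite rnorm_sqC !blinM blin1 adjEl.
rewrite (le_trans (nneg_sum_le _ _ h))//; first by move=> i; exact: sqr_ge0.
rewrite (le_trans (ler_norm _))// (le_trans (Re_ip_le _ _))//.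
by rewrite expr2 mulrA ler_wpM2r ?rnorm_ge0.
Qed.

Variables (D : blin G K) (d : I -> 'B(G)).
Hypothesis DE : forall i x, l2_coord i (D x) = d i x.

Lemma strong_sum_column b S x y : strong_sum (fun i => adj (d i) * b * d i) S ->
  '[amp b (D x), D y] = '[S x, y].
Proof.
move=> dS; apply: has_sum_unique (ip_has_sum _ _) _.
by apply: has_sum_ext (strong_sum_ip x y dS) => i; rewrite !blinM adjEl coord_amp !DE.
Qed.

(** Bounded operators preserve the strong convergence of a vector of K from its
    coordinates; all strong sums in the characterization arise in this way. *)
Lemma operator_sum_cvg {W : normedModType R[i]} (T : blin K W) (z : K) (e : R) : 0 < e ->
  exists J0, forall J, (J0 `<=` J)%fset ->
    rnorm (T z - \sum_(i <- J) T (l2_single i (l2_coord i z))) <= e.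
Proof.
move=> e0; have c0 : 0 < rnorm T + 1 by rewrite ltr_wpDl ?rnorm_ge0.
have [J0 h] := sum_l2_single_cvg z (divr_gt0 e0 c0).
exists J0 => J /h {}h; rewrite -blin_sum -blin_sub (le_trans (rnorm_blin _ _))//.
rewrite (le_trans (ler_wpM2l (rnorm_ge0 _) h))// mulrCA ger_pMr// ler_pdivrMr// mul1r lerDl//.
Qed.

Lemma column_strong_sum b (S : 'B(G)) : (forall x y, '[amp b (D x), D y] = '[S x, y]) ->
  strong_sum (fun i => adj (d i) * b * d i) S.
Proof.
move=> dS x; have SE : S x = adjoint D (amp b (D x)).
  by apply: ip_ext => y; rewrite adjointEl dS.
apply/(cvgrPdist_le (FF := @totally_filter I)) => e e0.
have [e' eE e'0] := gt0_complexE e0.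
have [J0 h] := operator_sum_cvg (adjoint D) (amp b (D x)) e'0.
exists J0 => // J /h {}h; rewrite /= partial_sumE eE -rnormE lecR SE.
apply: le_trans h; rewrite le_eqVlt; apply/orP; left; apply/eqP; congr (rnorm (_ - _)).
apply: eq_bigr => i _; apply: ip_ext => y.
by rewrite !blinM adjEl adjointEl ip_l2_single coord_amp !DE.
Qed.

Lemma operator_strong_column_sum (N : 'B(K)) (s : I -> 'B(G)) :
  (forall i x, l2_coord i (N (D x)) = s i x) ->
  strong_column_sum (fun i j => bcomp (l2_coord i) (bcomp N (l2_single j)) * d j) s.
Proof.
move=> sE; have tailE x J i : (s i - partial_sum (fun j =>
    bcomp (l2_coord i) (bcomp N (l2_single j)) * d j) J) x =
    l2_coord i (N (D x) - \sum_(j <- J) N (l2_single j (l2_coord j (D x)))).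
  rewrite blinB partial_sumE blin_sub sE blin_sum; congr (_ - _).
  by apply: eq_bigr => j _; rewrite !blinM !bcompE DE.
split=> [i x|x e e0].
  apply/(cvgrPdist_le (FF := @totally_filter I)) => e e0.
  have [e' eE e'0] := gt0_complexE e0.
  have [J0 h] := operator_sum_cvg N (D x) e'0.
  exists J0 => // J /h {}h.
  suff : `|l2_coord i (N (D x) - \sum_(j <- J) N (l2_single j (l2_coord j (D x))))| <= e.
    by rewrite -tailE.
  rewrite eE -rnormE lecR; apply: le_trans h; set z := (_ - _).
  have := sum_coord_le z [fset i]%fset; rewrite big_seq_fset1.
  by rewrite ler_pXn2r// nnegrE rnorm_ge0.
have [e' eE e'0] : exists2 e' : R, e = (e' ^+ 2)%:C & 0 < e'.
  have [r -> r0] := gt0_complexE e0; exists (Num.sqrt r); last by rewrite sqrtr_gt0.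
  by rewrite sqr_sqrtr// ltW.
have [J0 h] := operator_sum_cvg N (D x) e'0.
exists J0 => // J /h; set z := (_ - _) => {}h K'.
apply: (@le_trans _ _ (\sum_(i <- K') (rnorm (l2_coord i z) ^+ 2)%:C)).
  by apply: ler_sum => i _; rewrite rmorphXn [X in _ <= X ^+ 2]rnormE -tailE.
rewrite -rmorph_sum eE lecR (le_trans (sum_coord_le _ _))//.
by rewrite ler_pXn2r// ?nnegrE ?rnorm_ge0// ltW.
Qed.

End ColumnSums.

Section MatrixEntries.
Context {R : realType} {I : choiceType} {G : hilbert R}.
Local Notation K := (l2_hilbert I G).

Lemma coord_ip i (z : K) y : '[l2_coord i z, y] = '[z, l2_single i y].
Proof. by rewrite ipC -ip_l2_single -ipC. Qed.

Lemma amp_single (a : 'B(G)) (i : I) y : l2_single i (a y) = amp a (l2_single i y).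
Proof.
apply: l2_coord_ext => j; rewrite coord_amp !coord_single.
by case: eqP => // _; rewrite blin_zero.
Qed.

Lemma entry_adj (N N' : 'B(K)) i j : (forall z w, '[N z, w] = '[z, N' w]) ->
  bcomp (l2_coord i) (bcomp N' (l2_single j)) = adj (bcomp (l2_coord j) (bcomp N (l2_single i))).
Proof.
move=> NN'; apply/esym/adj_unique => x y.
by rewrite !bcompE coord_ip NN' ip_l2_single.
Qed.

Lemma masa_entry (C : set 'B(G)) (N : 'B(K)) i j : masa C ->
  (forall a z, C a -> N (amp a z) = amp a (N z)) ->
  C (bcomp (l2_coord i) (bcomp N (l2_single j))).
Proof.
move=> masaC NC; apply: (masa_commutant masaC) => a Ca; apply: blin_ext => y.
by rewrite !blinM !bcompE amp_single NC// coord_amp.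
Qed.

End MatrixEntries.

(** * The characterization of invariance *)
Theorem theorem1p2 (R : realType) (G : hilbert R) (I : choiceType)
    (T : R -> blin 'B(G) 'B(G)) (L : blin 'B(G) 'B(G))
    (l : I -> 'B(G)) (beta : 'B(G)) (C : set 'B(G)) :
  uc_normal_CP_semigroup T ->
  generator T L ->
  (forall b : 'B(G), strong_sum (fun i => adj (l i) * b * l i)
                        (L b - (b * beta + adj beta * b))) ->
  masa C ->
  (leaves_invariant L C <-> forall t, 0 <= t -> leaves_invariant (T t) C) /\
  (leaves_invariant L C <->
   exists (gamma : 'B(G)) (c_ : I -> 'B(G)) (cf : 'B(G) -> I -> I -> 'B(G)),
     [/\ C gamma /\ adj gamma = gamma,
         forall i, C (c_ i),
         forall c i j, C c -> C (cf c i j) &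
         forall c, C c ->
           [/\ forall i j, cf (adj c) i j = adj (cf c j i),
               strong_column_sum (fun i j => cf c i j * (l j - c_ j))
                                 (fun i => c * l i - l i * c) &
               strong_sum (fun i => adj (l i - c_ i) * c * (l i - c_ i))
                          (L c - gamma * c)]]).
Proof.
move=> _ TL LV masaC; split; first exact: (semigroup_invariance masaC TL).
split=> [LC|[gamma [c_ [cf [[Cg gg] Cc_ Ccf h]]]]].
  have [V VE] := strong_column_exists (LV 1).
  have LE b x y : '[amp b (V x), V y] =
      '[L b x, y] - '[beta x, adj b y] - '[b x, beta y].
    rewrite (strong_sum_column VE x y (LV b)) blinB blinD !blinM ipBl ipDl.
    by rewrite adjEl [ '[b (beta x), y] ]adjE opprD addrA.
  have [D [N [gamma [Ceta Nprop [Cg gg] gE]]]] := decomposition_exists masaC LE LC.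
  pose c_ i := bcomp (l2_coord i) (V - D).
  have DE i x : l2_coord i (D x) = (l i - c_ i) x.
    by rewrite blinB bcompE blinB blin_sub -VE subKr.
  exists gamma, c_, (fun c i j => bcomp (l2_coord i) (bcomp (N c) (l2_single j))); split=> //.
    move=> c i j Cc; have [_ _ Namp] := Nprop c Cc.
    exact: masa_entry.
  move=> c Cc; have [ND Nadj _] := Nprop c Cc; split.
  - by move=> i j; exact: entry_adj.
  - apply: (operator_strong_column_sum DE) => i x.
    by rewrite ND blin_sub coord_amp !VE.
  - by apply: (column_strong_sum DE) => x y; rewrite gE.
have [_ _ h1] := h 1 (masa1 masaC).
have [D DE] := strong_column_exists h1.
move=> b Cb; apply: (@coefficients_invariance _ _ _ C masaC D _ DE cf
  (fun c i => c * l i - l i * c) Ccf _ _ _ L gamma Cg _ b Cb).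
- by move=> c i j /h[].
- move=> c i x Cc; rewrite !blinB !blinM blin_sub.
  rewrite -[c (c_ i x)]blinM (masa_comm masaC Cc (Cc_ i)) blinM.
  by rewrite opprB addrA subrK.
- by move=> c /h[].
- by move=> c x y /h[_ _ hc]; exact: (strong_sum_column DE).
Qed.
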